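(* Let $\nu$ be a generalized semiclassical weight on $\mathbb T$, with associated finite set $\mathcal Z_A$. Then for every $n\in\mathbb N$ the structure matrix $M_n$ is a holomorphic function in $\mathbb C\setminus\mathcal Z_A$ (that is, $M_n$, defined off $\mathbb T\cup\mathcal Z_A$, extends holomorphically across $\mathbb T\setminus\mathcal Z_A$).
   Context: $\mathbb N=\{1,2,\dots\}$, $\mathbb T=\{|z|=1\}$ (counterclockwise). $\nu$ is a positive integrable weight on $\mathbb T$ and $d\mu(z)=\frac{\nu(z)}{\mathrm i z}dz$. $\Phi_n$ is the monic polynomial of degree $n$ with $\int_{\mathbb T}\Phi_n\overline{\Phi_m}\,d\mu=\kappa_n^{-2}\delta_{n,m}$, $\kappa_n>0$; $\Phi_n^*(z)=z^n\overline{\Phi_n(1/\bar z)}$; $b_n=2\pi\kappa_n^2$. For $z\notin\mathbb T$, $$G_n(z)=\frac1{2\pi \mathrm i}\int_{\mathbb T}\frac{\Phi_n(t)}{t-z}\frac{\nu(t)}{t^n}dt,\quad G_{n-1}^*(z)=\frac1{2\pi \mathrm i}\int_{\mathbb T}\frac{\Phi_{n-1}^*(t)}{t-z}\frac{\nu(t)}{t^n}dt,\quad Y_n=\begin{bmatrix}\Phi_n&G_n\\-b_{n-1}\Phi_{n-1}^*&-b_{n-1}G_{n-1}^*\end{bmatrix}\quad(n\in\mathbb N).$$ Generalized semiclassical weight: $\nu$ satisfies $zA(z)\nu'(z)=q(z)\nu(z)$ off the set $\mathcal Z_A$ of zeros of $zA(z)$, where $A$ is a (nonzero) polynomial and $q$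 is entire. Off $\mathcal Z_A$, $\nu$ denotes the (possibly multivalued, nonvanishing) analytic function determined by this equation and the weight on $\mathbb T\setminus \mathcal Z_A$. $C_n(z)=\operatorname{diag}\big(z^{-n/2}\nu(z)^{1/2},\,z^{n/2}\nu(z)^{-1/2}\big)$, $Z_n=Y_nC_n$, $M_n=Z_n'Z_n^{-1}=Y_n'Y_n^{-1}+Y_nC_n'C_n^{-1}Y_n^{-1}$. Local analytic branches are used for the powers; $C_n'C_n^{-1}=\big(-\frac n{2z}+\frac{q(z)}{2zA(z)}\big)\operatorname{diag}(1,-1)$ and $M_n$ do not depend on the branches and are single valued on $\mathbb C\setminus(\mathbb T\cup\mathcal Z_A)$. *)

(* Defs.v *)
From HB Require Import structures.
From mathcomp Require Import all_boot all_order all_algebra.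
From mathcomp Require Import all_classical all_reals all_analysis.
From mathcomp Require Import complex ring.
Set Implicit Arguments.
Unset Strict Implicit.
Unset Printing Implicit Defensive.
Import Order.TTheory GRing.Theory Num.Theory.
Import numFieldNormedType.Exports.
Local Open Scope classical_set_scope.
Local Open Scope complex_scope.
Local Open Scope ring_scope.

(* R[i] carries no topology in the libraries. Packing it as a numFieldType    *)
(* gives it the norm topology `|x +i* y| = sqrt (x^2 + y^2), and makes        *)
(* [derivable f z 1] and [derive1 f z] complex differentiability and the      *)
(* complex derivative.                                                        *)
Definition Cplx (R : realType) : numFieldType := R[i].
Arguments Cplx : simpl never.

Section Log_derivative.
Context {K : numFieldType}.
Implicit Types (f g : K -> K) (z a b : K).

Definition dlog f z a : Prop := is_derive z 1 f (a * f z).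

Lemma dlogM f g z a b :
  dlog f z a -> dlog g z b -> dlog (fun w => f w * g w) z (a + b).
Proof.
move=> hf hg; rewrite /dlog.
apply: is_derive_eq; first exact: (@is_deriveM _ _ f g z 1 _ _ hf hg).
by rewrite /GRing.scale /=; ring.
Qed.

Lemma dlogX f z a n : dlog f z a -> dlog (fun w => f w ^+ n) z (n%:R * a).
Proof.
move=> hf; elim: n => [|n IHn].
  rewrite /dlog !mul0r.
  exact: is_derive_cst.
have -> : (fun w => f w ^+ n.+1) = (fun w => f w * f w ^+ n).
  by apply/funext => w; rewrite exprS.
by rewrite -addn1 natrD mulrDl mul1r addrC; exact: dlogM.
Qed.

Lemma dlogV f z a : f z != 0 -> dlog f z a -> dlog (fun w => (f w)^-1) z (- a).
Proof.
move=> fz0 [df Df]; apply: DeriveDef; first exact: derivableV.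
by rewrite deriveV // Df /GRing.scale /=; field.
Qed.

Lemma dlog_sqrt f g z :
  derivable f z 1 -> f z != 0 -> (\near z, f z ^+ 2 = g z) ->
  dlog f z (derive1 g z / (2 * g z)).
Proof.
move=> df fz0 fg; apply: DeriveDef => //.
have hf : dlog f z ('D_1 f z / f z).
  by apply: DeriveDef => //; rewrite divfK.
have [_ e] := dlogX 2 hf.
have fgz : f z ^+ 2 = g z := nbhs_singleton fg.
rewrite derive1E -(near_eq_derive _ fg) e -fgz.
by field.
Qed.
End Log_derivative.

Section Complex.
Context {R : realType}.
Local Notation C := (Cplx R).

Definition toC (x : R) : C := x%:C.
Definition conjC (z : C) : C := conjc z.
Definition iC : C := 'i%C.
Definition expi (x : R) : C := (cos x +i* sin x).

Definition unit_circle : set C := [set z | `|z| = 1].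

Definition holomorphic_on (D : set C) (f : C -> C) : Prop :=
  forall z, D z -> derivable f z 1.

Definition entire (f : C -> C) : Prop := holomorphic_on setT f.

Definition Cintegral (D : set R) (f : R -> C) : C :=
  (\int[lebesgue_measure]_(x in D) complex.Re (f x))
    +i* (\int[lebesgue_measure]_(x in D) complex.Im (f x)).

(* \int_T f(z) dz, with T counterclockwise and z = expi x, dz = i expi x dx *)
Definition circle_integral (f : C -> C) : C :=
  Cintegral `[0, 2 * pi] (fun x => f (expi x) * (iC * expi x)).

Definition mx2 (a b c d : C) : 'M[C]_2 :=
  \matrix_(i < 2, j < 2)
    if i == 0 then (if j == 0 then a else b) else (if j == 0 then c else d).

Lemma mul_mx2_diag (B : 'M[C]_2) (a d : C) (i j : 'I_2) :
  (B *m mx2 a 0 0 d) i j = B i j * (if j == 0 then a else d).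
Proof.
rewrite mxE !big_ord_recl big_ord0 addr0 !mxE /=.
case: (unliftP 0 j) => [k|] ->; last by rewrite mulr0 addr0.
by rewrite (ord1 k) /= mulr0 add0r.
Qed.

Definition mx_holomorphic_on (D : set C) (M : C -> 'M[C]_2) : Prop :=
  forall i j, holomorphic_on D (fun z => M z i j).

Definition mx_derive (M : C -> 'M[C]_2) (z : C) : 'M[C]_2 :=
  \matrix_(i < 2, j < 2) derive1 (fun w => M w i j) z.

(* Only the values of nu on the unit circle are relevant. Positivity is       *)
(* almost everywhere, so that weights such as |z - 1|^(2a) are covered.       *)
Definition weight (nu : C -> R) : Prop :=
  {ae @lebesgue_measure R, forall x : R, 0 < nu (expi x)} /\
  (@lebesgue_measure R).-integrable `[0, 2 * pi]
    (fun x => (nu (expi x))%:E).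

(* \int_T f dmu with dmu(z) = nu(z) / (i z) dz *)
Definition mu_integral (nu : C -> R) (f : C -> C) : C :=
  circle_integral (fun z => f z * (toC (nu z) / (iC * z))).

Definition monic_orthogonal (nu : C -> R) (Phi : nat -> {poly C})
    (kappa : nat -> R) : Prop :=
  forall n : nat,
    [/\ Phi n \is monic, size (Phi n) = n.+1, 0 < kappa n &
        forall m : nat,
          mu_integral nu (fun z => (Phi n).[z] * conjC (Phi m).[z]) =
          toC (kappa n ^- 2 * (n == m)%:R)].

(* p^*(z) = z^n conj(p(1/conj z)) for p of degree n, see [reverseE]; given by *)
(* its coefficients so that it is also correct at z = 0.                      *)
Definition reverse (n : nat) (p : {poly C}) : {poly C} :=
  \poly_(k < n.+1) conjC p`_(n - k).

Lemma reverseE (n : nat) (p : {poly C}) (z : C) :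
  (size p <= n.+1)%N -> z != 0 ->
  (reverse n p).[z] = z ^+ n * conjC p.[(conjC z)^-1].
Proof.
move=> sp z0; rewrite /reverse horner_poly (horner_coef_wide _ sp).
have gen (c : {rmorphism C -> C}) : involutive c ->
    \sum_(i < n.+1) c p`_(n - i) * z ^+ i =
    z ^+ n * c (\sum_(i < n.+1) p`_i * (c z)^-1 ^+ i).
  move=> cK; rewrite rmorph_sum /= mulr_sumr (reindex_inj rev_ord_inj) /=.
  apply: eq_bigr => i _; rewrite subSS subKn; last by rewrite -ltnS.
  rewrite rmorphM rmorphXn fmorphV /= cK mulrCA; congr (_ * _).
  have le_in : (i <= n)%N by rewrite -ltnS.
  by rewrite exprVn -[LHS](mulfK (expf_neq0 i z0)) -exprD subnK.
exact: (gen (@conjc R : {rmorphism C -> C}) (@conjcK R)).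
Qed.

(* z |-> 1/(2 pi i) \int_T p(t) / (t - z) * nu(t) / t^n dt *)
Definition cauchy_transform (nu : C -> R) (n : nat) (p : {poly C}) (z : C) : C :=
  (toC (2 * pi) * iC)^-1 *
  circle_integral (fun t => p.[t] / (t - z) * (toC (nu t) / t ^+ n)).

Section Structure_matrix.
Variables (nu : C -> R) (Phi : nat -> {poly C}) (kappa : nat -> R).
Variables (A : {poly C}) (q : C -> C).

Definition b_coef (n : nat) : R := 2 * pi * kappa n ^+ 2.

(* Meant for n >= 1. *)
Definition Y_mx (n : nat) (z : C) : 'M[C]_2 :=
  let PhiS := reverse n.-1 (Phi n.-1) in
  mx2 (Phi n).[z] (cauchy_transform nu n (Phi n) z)
      (- toC (b_coef n.-1) * PhiS.[z])
      (- toC (b_coef n.-1) * cauchy_transform nu n PhiS z).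

Definition zeros_zA : set C := [set z | z * A.[z] = 0].

(* The analytic function nu off the zeros of z A(z) enters through its germs  *)
(* at the points of the circle: the equation is linear, so these continue     *)
(* along every path avoiding the zeros.                                       *)
Definition generalized_semiclassical : Prop :=
  [/\ A != 0, entire q &
      forall z0, unit_circle z0 -> ~ zeros_zA z0 ->
      exists U : set C, exists f : C -> C,
        [/\ open_nbhs z0 U, holomorphic_on U f,
            forall z, U z -> unit_circle z -> f z = toC (nu z) &
            forall z, U z -> z * A.[z] * derive1 f z = q z * f z]].

(* C_n'(z) C_n(z)^-1 *)
Definition dlogC_mx (n : nat) (z : C) : 'M[C]_2 :=
  (- (n%:R / (2 * z)) + q z / (2 * z * A.[z])) *: mx2 1 0 0 (-1).

(* M_n = Z_n' Z_n^-1 = Y_n' Y_n^-1 + Y_n C_n' C_n^-1 Y_n^-1, written in the   *)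
(* form which involves no choice of branches, see [structure_mxE].            *)
Definition structure_mx (n : nat) (z : C) : 'M[C]_2 :=
  mx_derive (Y_mx n) z *m invmx (Y_mx n z)
  + Y_mx n z *m dlogC_mx n z *m invmx (Y_mx n z).

(* diag(z^(-n/2) nu^(1/2), z^(n/2) nu^(-1/2)) from local branches r of        *)
(* z^(1/2) and s of nu^(1/2) *)
Definition C_mx (r s : C -> C) (n : nat) (z : C) : 'M[C]_2 :=
  mx2 (r z ^- n * s z) 0 0 (r z ^+ n / s z).

Lemma structure_mxE (n : nat) (z : C) (r s nuf : C -> C) :
  ~ zeros_zA z ->
  (forall i j, derivable (fun w => Y_mx n w i j) z 1) ->
  Y_mx n z \in unitmx ->
  derivable r z 1 -> derivable s z 1 -> nuf z != 0 ->
  (\forall w \near z, r w ^+ 2 = w /\ s w ^+ 2 = nuf w) ->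
  z * A.[z] * derive1 nuf z = q z * nuf z ->
  let Z w := Y_mx n w *m C_mx r s n w in
  mx_derive Z z *m invmx (Z z) = structure_mx n z.
Proof.
move=> /eqP; rewrite mulf_eq0 negb_or => /andP[z0 A0] dY uY dr ds nu0 nearz.
move=> nuE Z.
have [r2 s2] := nbhs_singleton nearz.
have rz0 : r z != 0 by apply: contra_neq z0 => r0; rewrite -r2 r0 expr0n.
have sz0 : s z != 0 by apply: contra_neq nu0 => s0; rewrite -s2 s0 expr0n.
pose d := - (n%:R / (2 * z)) + q z / (2 * z * A.[z]).
have Dr : dlog r z (1 / (2 * z)).
  have r2near : \forall w \near z, r w ^+ 2 = w.
    by apply: filterS nearz => w [].
  have := @dlog_sqrt _ r (fun w => w) z dr rz0 r2near.
  by rewrite derive1E derive_id.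
have Ds : dlog s z (q z / (2 * z * A.[z])).
  have -> : q z / (2 * z * A.[z]) = derive1 nuf z / (2 * nuf z).
    have -> : derive1 nuf z = q z * nuf z / (z * A.[z]).
      by rewrite -nuE mulrC mulKf // mulf_neq0.
    by field; rewrite nu0 z0 A0.
  by apply: dlog_sqrt => //; apply: filterS nearz => w [].
have rn0 : r z ^+ n != 0 by rewrite expf_neq0.
have Dc (j : 'I_2) :
    dlog (fun w => C_mx r s n w j j) z (if j == 0 then d else - d).
  have Drn := dlogX n Dr.
  case: (eqVneq j 0) => [->|j0].
    have -> : (fun w => C_mx r s n w 0 0) = (fun w => r w ^- n * s w).
      by apply/funext => w; rewrite mxE.
    have -> : d = - (n%:R * (1 / (2 * z))) + q z / (2 * z * A.[z]).
      by rewrite mul1r.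
    exact: dlogM (@dlogV _ (fun w => r w ^+ n) _ _ rn0 Drn) Ds.
  have -> : (fun w => C_mx r s n w j j) = (fun w => r w ^+ n * (s w)^-1).
    by apply/funext => w; rewrite mxE (negPf j0).
  have -> : - d = n%:R * (1 / (2 * z)) + - (q z / (2 * z * A.[z])).
    by rewrite mul1r opprD opprK.
  exact: dlogM Drn (dlogV sz0 Ds).
have ZE i j : (fun w => Z w i j) = (fun w => Y_mx n w i j * C_mx r s n w j j).
  apply/funext => w; rewrite /Z mul_mx2_diag; congr (_ * _).
  by rewrite mxE; case: (j == 0).
have uC : C_mx r s n z \in unitmx.
  rewrite unitmxE unitfE (expand_det_row _ 0) !big_ord_recl big_ord0 /cofactor.
  rewrite !det_mx11 !mxE /= mul0r !addr0 expr0 mul1r.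
  by rewrite !mulf_neq0 ?invr_neq0.
have Z'E : mx_derive Z z =
    (mx_derive (Y_mx n) z + Y_mx n z *m dlogC_mx n z) *m C_mx r s n z.
  apply/matrixP => i j; rewrite mxE ZE.
  have [dc Ec] := Dc j.
  rewrite derive1E (deriveM (dY i j) dc) Ec -!derive1E.
  rewrite /dlogC_mx -/d -scalemxAr /C_mx mul_mx2_diag.
  have addE (B V : 'M[C]_2) : (B + d *: V) i j = B i j + d * V i j.
    by rewrite !mxE.
  rewrite addE mul_mx2_diag !mxE.
  rewrite /GRing.scale /=.
  by case: (j == 0); ring.
have -> : invmx (Z z) = invmx (C_mx r s n z) *m invmx (Y_mx n z).
  apply: (can_inj (mulmxK uY)); rewrite mulmxKV //.
  apply: (can_inj (mulmxK uC)); rewrite mulVmx // -mulmxA mulVmx //.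
  by rewrite unitmx_mul uY.
by rewrite Z'E mulmxA mulmxK // mulmxDl.
Qed.

End Structure_matrix.

End Complex.

(* Main.v *)
(* Y_n has determinant 1 off the circle, and crossing the circle multiplies   *)
(* it on the right by [[1, omega], [0, 1]] with omega = nu / z^n. As          *)
(* omega' = 2 delta omega, where C_n' C_n^-1 = delta diag(1, -1), this jump   *)
(* disappears from Y_n' Y_n^-1 + Y_n C_n' C_n^-1 Y_n^-1. So near a point of   *)
(* the circle where nu has an analytic germ, M_n is computed on both sides    *)
(* from one analytic continuation of Y_n.                                     *)
(*                                                                            *)
(* The continuation comes from subtracting the density: if h is the analytic  *)
(* germ of the density u near z0, then \int u(t)/(t - z) dt equals            *)
(*   \int_far (u(t) - h(z))/(t - z) dt + \int_near (h(t) - h(z))/(t - z) dt   *)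
(*     + h(z) \int dt/(t - z).                                                *)
(* The last integral is 2 pi i inside the circle and 0 outside; the others    *)
(* are holomorphic near z0, the divided difference of h being a Cauchy        *)
(* integral over a small circle around z0. Since h is C^1 by its differential *)
(* equation, Cauchy's formula follows by contracting the circle.              *)
Require Import Defs.
From HB Require Import structures.
From mathcomp Require Import all_boot all_order all_algebra.
From mathcomp Require Import all_classical all_reals all_analysis.
From mathcomp Require Import measurable_realfun complex ring lra.
Set Implicit Arguments.
Unset Strict Implicit.
Unset Printing Implicit Defensive.
Import Order.TTheory GRing.Theory Num.Theory.
Import numFieldNormedType.Exports.
Local Open Scope classical_set_scope.
Local Open Scope ring_scope.

(** * Complex numbers and integrals over the circle *)

(** Since det Y_n = 1 off the circle ([det_Y]), the inverse of Y_n is its adjugate, and M_n is a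
    polynomial expression [log_derivative_mx] in the entries of Y_n, their derivatives and the
    scalar delta of C_n' C_n^-1 ([structure_mx_log_derivative]). Off the circle the entries are
    polynomials and Cauchy transforms, so M_n is holomorphic there wherever z A(z) is nonzero.

    Near a point of the circle, [cauchy_jump] writes each Cauchy transform as E + h inside and E
    outside, with E and h holomorphic on a full neighbourhood. For the two transforms in Y_n, h is
    Phi_n, respectively the reversed Phi_(n-1), times the same omega, so Y_n is a holomorphic matrix
    times a unipotent factor with entry omega or 0. Both omega and 0 solve w' = 2 delta w
    ([derive_omega]), and under such a factor the expression does not change
    ([log_derivative_mx_jump]). One holomorphic formula thus gives M_n on both sides
    ([local_extension_circle]). The local extensions agree with the limit of M_n through points off
    the circle, which defines the global extension.

    The analytic input is Cauchy's formula ([cauchy_homotopy], [winding_inside], [winding_outside],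
    [cauchy_formula]) and derivation under the integral by quadratic remainders
    ([is_derive_quadratic]). As M_n contains Y_n', its differentiability takes second derivatives of
    the entries, and these are tracked by [smooth_at]. *)

Section Complex_numbers.
Context {R : realType}.
Local Notation C := (Cplx R).
Local Notation Re := (@complex.Re R).
Local Notation Im := (@complex.Im R).
Implicit Types (z w : C) (x : R).

Lemma toCD x y : toC (x + y) = toC x + toC y :> C.
Proof. exact: (rmorphD (real_complex R)). Qed.

Lemma toCM x y : toC (x * y) = toC x * toC y :> C.
Proof. exact: (rmorphM (real_complex R)). Qed.

Lemma toC_eq0 x : (toC x == 0 :> C) = (x == 0).
Proof. exact: (fmorph_eq0 (real_complex R)). Qed.

Lemma toCV x : toC x^-1 = (toC x)^-1 :> C.
Proof. exact: (fmorphV (real_complex R)). Qed.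

Lemma toCB x y : toC (x - y) = toC x - toC y :> C.
Proof. exact: (rmorphB (real_complex R)). Qed.

Lemma toC0 : toC 0 = 0 :> C. Proof. by []. Qed.

Lemma toC1 : toC 1 = 1 :> C. Proof. by []. Qed.

Lemma ler_toC x y : (toC x <= toC y) = (x <= y).
Proof. exact: lecR. Qed.

Lemma ltr_toC x y : (toC x < toC y) = (x < y).
Proof. exact: ltcR. Qed.

Lemma toC_real (z : C) : 0 <= z -> z = toC (Re z).
Proof. by case: z => a b; rewrite lecE /= => /andP[/eqP -> _]. Qed.

Lemma normC_Re z : `|z| = toC (Re `|z|).
Proof. exact/toC_real/normr_ge0. Qed.

Lemma cReM z w : Re (z * w) = Re z * Re w - Im z * Im w.
Proof. by case: z w => [a b] [c d]. Qed.

Lemma cImM z w : Im (z * w) = Re z * Im w + Im z * Re w.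
Proof. by case: z w => [a b] [c d]. Qed.

Lemma cReD z w : Re (z + w) = Re z + Re w.
Proof. by case: z w => [a b] [c d]. Qed.

Lemma cImD z w : Im (z + w) = Im z + Im w.
Proof. by case: z w => [a b] [c d]. Qed.

Lemma cReN z : Re (- z) = - Re z. Proof. by case: z. Qed.
Lemma cImN z : Im (- z) = - Im z. Proof. by case: z. Qed.

Lemma eq_ReIm z w : Re z = Re w -> Im z = Im w -> z = w.
Proof. by case: z w => [a b] [c d] /= -> ->. Qed.

Lemma norm_Re_le z : toC `|Re z| <= `|z|.
Proof. exact: normc_ge_Re. Qed.

Lemma norm_Im_le z : toC `|Im z| <= `|z|.
Proof.
have -> : `|z| = `|z * iC| by rewrite normrM (_ : `|iC| =
  1 :> C) ?mulr1 // /iC normc_def /= expr0n /= expr1n add0r sqrtr1.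
apply: le_trans (norm_Re_le _).
by rewrite cReM /= mulr0 mulr1 sub0r normrN.
Qed.

Lemma normC_le z : `|z| <= toC (`|Re z| + `|Im z|).
Proof.
have {1}-> : z = toC (Re z) + toC (Im z) * iC.
  by apply: eq_ReIm; rewrite ?cReD ?cImD ?cReM ?cImM /=; ring.
apply: le_trans (ler_normD _ _) _.
rewrite normrM (_ : `|iC| = 1 :> C) ?mulr1; last first.
  by rewrite /iC normc_def /= expr0n /= expr1n add0r sqrtr1.
have n x : `|toC x| = toC `|x| :> C.
  by rewrite {1}/toC normc_def /= expr0n /= addr0 sqrtr_sqr.
by rewrite !n -toCD.
Qed.

Lemma norm_toC x : `|toC x| = toC `|x| :> C.
Proof. by rewrite {1}/toC normc_def /= expr0n /= addr0 sqrtr_sqr. Qed.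

(** This is the bridge by which results of real analysis (measurability, compactness, the
    fundamental theorem) are applied to each coordinate. *)
Lemma cvg_toC (T : Type) (F : set_system T) (FF : Filter F) (f : T ->
  C) (l : C) :
  (f @ F --> l) <-> (Re (f t) @[t --> F] --> Re l /\ Im (f t) @[t --> F] --> Im l).
Proof.
split=> [fl|[fRe fIm]].
  split; apply/cvgrPdist_lt => e e0.
    move/cvgrPdist_lt : fl => /(_ (toC e)); rewrite ltr_toC => /(_ e0).
    apply: filterS => t; rewrite -cReN -cReD -ltr_toC; apply: le_lt_trans.
    exact: norm_Re_le.
  move/cvgrPdist_lt : fl => /(_ (toC e)); rewrite ltr_toC => /(_ e0).
  apply: filterS => t; rewrite -cImN -cImD -ltr_toC; apply: le_lt_trans.
  exact: norm_Im_le.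
apply/cvgrPdist_lt => e e0.
have e2 : 0 < Re e / 2 by rewrite divr_gt0 // -ltr_toC -toC_real // ltW.
move/cvgrPdist_lt : fRe => /(_ _ e2) fRe.
move/cvgrPdist_lt : fIm => /(_ _ e2) fIm.
near=> t.
apply: le_lt_trans (normC_le _) _.
rewrite (toC_real (ltW e0)) ltr_toC (splitr (Re e)) ltrD //.
  by rewrite cReD cReN; near: t.
by rewrite cImD cImN; near: t.
Unshelve. all: by end_near. Qed.

Lemma norm_expi x : `|expi x| = 1 :> C.
Proof. by rewrite normc_def /= cos2Dsin2 sqrtr1. Qed.

Lemma expi_neq0 x : expi x != 0 :> C.
Proof. by rewrite -normr_eq0 norm_expi oner_eq0. Qed.

Lemma expi0 : expi 0 = 1 :> C.
Proof. by apply: eq_ReIm; rewrite /= ?cos0 ?sin0. Qed.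

Lemma expi2pi : expi (2 * pi) = 1 :> C.
Proof. by apply: eq_ReIm; rewrite /= mulr_natl ?cos2pi ?sin2pi. Qed.

Lemma iC_neq0 : iC != 0 :> C.
Proof. by apply/eqP => /(congr1 Im) /= /eqP; rewrite oner_eq0. Qed.

Lemma cconjM z w : conjC (z * w) = conjC z * conjC w.
Proof. exact: (rmorphM (@conjc R)). Qed.

Lemma cconjB z w : conjC (z - w) = conjC z - conjC w.
Proof. exact: (rmorphB (@conjc R)). Qed.

Lemma cconjD z w : conjC (z + w) = conjC z + conjC w.
Proof. exact: (rmorphD (@conjc R)). Qed.

Lemma cconj1 : conjC 1 = 1 :> C.
Proof. exact: (rmorph1 (@conjc R)). Qed.

Lemma cconjV z : conjC z^-1 = (conjC z)^-1.
Proof. exact: (fmorphV (@conjc R)). Qed.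

Lemma cconjX z n : conjC (z ^+ n) = conjC z ^+ n.
Proof. exact: (rmorphXn (@conjc R)). Qed.

Lemma cconjK z : conjC (conjC z) = z.
Proof. exact: conjcK. Qed.

Lemma conjC_expi x : conjC (expi x) = (expi x)^-1 :> C.
Proof.
apply: (mulIf (expi_neq0 x)); rewrite mulVf ?expi_neq0 //.
apply: eq_ReIm; rewrite ?cReM ?cImM /=; last by ring.
by rewrite mulNr opprK -!expr2 cos2Dsin2.
Qed.

End Complex_numbers.

(** * Measurability and integrability of complex functions on [0, 2 pi] *)

Section Complex_integrals.
Context {R : realType}.
Local Notation C := (Cplx R).
Local Notation Re := (@complex.Re R).
Local Notation Im := (@complex.Im R).
Local Notation mu := (@lebesgue_measure R).
Local Notation D := (`[0, 2 * @pi R]%classic).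
Implicit Types (f g : R -> C).

Definition cmeasurable f :=
  measurable_fun D (fun x => Re (f x)) /\
  measurable_fun D (fun x => Im (f x)).

Definition cintegrable f :=
  mu.-integrable D (fun x => (Re (f x))%:E) /\
  mu.-integrable D (fun x => (Im (f x))%:E).

Let mD : measurable (D : set (measurableTypeR R)). Proof. exact: measurable_itv. Qed.

(** Inversion is continuous on the open set of nonzero reals, and the remaining point 0 is a
    measurable piece by itself. *)
Lemma measurable_invr : measurable_fun setT (@GRing.inv R).
Proof.
have -> : setT = [set x : R | x != 0] `|` [set 0].
  by apply/seteqP; split=> // x _ /=; case: eqP; [right|left].
have op : open [set x : R | x != 0].
  have -> : [set x : R | x != 0] = ~` [set 0].
    by apply/seteqP; split=> x /= /eqP.
  exact/closed_openC/closed_eq.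
apply/measurable_funU => //; first exact: open_measurable.
split; last exact: measurable_fun_set1.
apply: open_continuous_measurable_fun => // x; rewrite inE /= => x0.
exact: inv_continuous.
Qed.

Lemma cmeasurable_cst (a : C) : cmeasurable (fun=> a).
Proof. by split; exact: measurable_cst. Qed.

Let eq_meas (f1 f2 : R -> R) : f1 =1 f2 ->
  measurable_fun D f2 -> measurable_fun D f1.
Proof. by move=> /funext ->. Qed.

Lemma cmeasurableD f g :
  cmeasurable f -> cmeasurable g -> cmeasurable (fun x => f x + g x).
Proof.
move=> [f1 f2] [g1 g2]; split.
  by apply: eq_meas => [x|]; [exact: cReD|exact: (measurable_funD f1 g1)].
by apply: eq_meas => [x|]; [exact: cImD|exact: (measurable_funD f2 g2)].
Qed.

Lemma cmeasurableM f g :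
  cmeasurable f -> cmeasurable g -> cmeasurable (fun x => f x * g x).
Proof.
move=> [f1 f2] [g1 g2]; split.
  apply: eq_meas => [x|]; first exact: cReM.
  exact: (measurable_funB (measurable_funM f1 g1) (measurable_funM f2 g2)).
apply: eq_meas => [x|]; first exact: cImM.
exact: (measurable_funD (measurable_funM f1 g2) (measurable_funM f2 g1)).
Qed.

Lemma cmeasurableV f : cmeasurable f -> cmeasurable (fun x => (f x)^-1).
Proof.
move=> [f1 f2].
have n2 : measurable_fun D (fun x => (Re (f x) ^+ 2 + Im (f x) ^+ 2)^-1).
  apply: (measurableT_comp measurable_invr).
  by apply: measurable_funD; exact: measurable_funX.
split.
  apply: (@eq_measurable_fun _ _ _ _ _ (fun x =>
    Re (f x) * (Re (f x) ^+ 2 + Im (f x) ^+ 2)^-1)).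
    by move=> x _; case: (f x).
  exact: measurable_funM.
apply: (@eq_measurable_fun _ _ _ _ _ (fun x =>
  - (Im (f x) * (Re (f x) ^+ 2 + Im (f x) ^+ 2)^-1))).
  by move=> x _; case: (f x).
by apply: measurableT_comp => //; exact: measurable_funM.
Qed.

Lemma cmeasurableX f n : cmeasurable f -> cmeasurable (fun x => f x ^+ n).
Proof.
move=> mf; elim: n => [|n IHn].
  exact: (cmeasurable_cst 1).
have -> : (fun x => f x ^+ n.+1) = (fun x => f x * f x ^+ n).
  by apply/funext => x; rewrite exprS.
exact: cmeasurableM.
Qed.

Lemma cmeasurable_expi : cmeasurable expi.
Proof.
split; apply: measurable_funTS.
  exact: (continuous_measurable_fun (@continuous_cos R)).
exact: (continuous_measurable_fun (@continuous_sin R)).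
Qed.

(** Made for integrands cut off to the arc near a point of the circle: they may be discontinuous at
    the ends of the arc. *)
Lemma cmeasurable_restrict (S : set R) f : open S ->
  (forall x, S x -> {for x, continuous f}) -> (forall x, ~ S x -> f x = 0) ->
  cmeasurable f.
Proof.
move=> oS cS f0.
have aux (h : C -> R) : h 0 = 0 ->
    (forall x, S x -> {for x, continuous (fun x => h (f x))}) ->
    measurable_fun setT (fun x => h (f x)).
  move=> h0 ch; rewrite -(setUv S); apply/measurable_funU.
  - exact: open_measurable.
  - by apply: measurableC; exact: open_measurable.
  split; first by apply: open_continuous_measurable_fun => // x /[!inE] /ch.
  apply: (@eq_measurable_fun _ _ _ _ _ (cst (0 : R)));
    last exact: measurable_cst.
  by move=> x /[!inE] /= Sx; rewrite f0.
split; apply: measurable_funTS; apply: aux => // x Sx;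
  by have /cvg_toC[] := cS _ Sx.
Qed.

Let eq_int (f1 f2 : R -> R) : f1 =1 f2 ->
  mu.-integrable D (fun x => (f2 x)%:E) -> mu.-integrable D (fun x =>
    (f1 x)%:E).
Proof. by move=> /funext ->. Qed.

Lemma cintegrableD f g :
  cintegrable f -> cintegrable g -> cintegrable (fun x => f x + g x).
Proof.
move=> [f1 f2] [g1 g2]; split.
  by apply: eq_int => [x|]; [exact: cReD|exact: (integrableD mD f1 g1)].
by apply: eq_int => [x|]; [exact: cImD|exact: (integrableD mD f2 g2)].
Qed.

Lemma cintegrableZl (a : C) f : cintegrable f -> cintegrable (fun x => a * f x).
Proof.
move=> [f1 f2]; split.
  apply: eq_int => [x|]; first exact: cReM.
  exact: (integrableB mD (integrableZl mD (Re a) f1) (integrableZl mD (Im a) f2)).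
apply: eq_int => [x|]; first exact: cImM.
exact: (integrableD mD (integrableZl mD (Re a) f2) (integrableZl mD (Im a) f1)).
Qed.

Lemma CintegralD f g : cintegrable f -> cintegrable g ->
  Cintegral D (fun x => f x + g x) = Cintegral D f + Cintegral D g.
Proof.
move=> [f1 f2] [g1 g2]; apply: eq_ReIm; rewrite ?cReD ?cImD /=.
  by rewrite -RintegralD //; apply: eq_Rintegral => x _; rewrite cReD.
by rewrite -RintegralD //; apply: eq_Rintegral => x _; rewrite cImD.
Qed.

Lemma CintegralZl (a : C) f : cintegrable f ->
  Cintegral D (fun x => a * f x) = a * Cintegral D f.
Proof.
move=> [f1 f2]; apply: eq_ReIm; rewrite ?cReM ?cImM /=.
  rewrite -!RintegralZl // -RintegralB;
    [|by []|exact: (integrableZl mD _ f1)|exact: (integrableZl mD _ f2)].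
  by apply: eq_Rintegral => x _; rewrite cReM.
rewrite -!RintegralZl // -RintegralD;
  [|by []|exact: (integrableZl mD _ f2)|exact: (integrableZl mD _ f1)].
by apply: eq_Rintegral => x _; rewrite cImM.
Qed.

Lemma eq_Cintegral f g : (forall x, D x -> f x = g x) ->
  Cintegral D f = Cintegral D g.
Proof.
by move=> fg; apply: eq_ReIm; apply: eq_Rintegral => x /set_mem /fg ->.
Qed.

Lemma Cintegral_cst (a : C) : Cintegral D (fun=> a) = toC (2 * pi) * a.
Proof.
have l : fine (mu D) = 2 * pi.
  rewrite lebesgue_measure_itv /= lte_fin mulr_gt0 // ?pi_gt0 //= oppr0 addr0.
  by [].
by apply: eq_ReIm; rewrite ?cReM ?cImM /= Rintegral_cst // l; ring.
Qed.

(** The coordinates are estimated separately, which costs the factor 2. This is harmless, as the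
    bound is only used up to a constant. *)
Lemma norm_Cintegral_le f (m : R -> R) : cintegrable f ->
  mu.-integrable D (fun x => (m x)%:E) ->
  (forall x, D x -> `|f x| <= toC (m x)) ->
  `|Cintegral D f| <= toC (2 * \int[mu]_(x in D) m x).
Proof.
move=> [f1 f2] im fm.
have aux (h : C -> R) : mu.-integrable D (fun x => (h (f x))%:E) ->
    (forall z, toC `|h z| <= `|z|) ->
    `|\int[mu]_(x in D) h (f x)| <= \int[mu]_(x in D) m x.
  move=> ih hn; apply: le_trans (le_normr_Rintegral _ ih) _ => //.
  apply: le_Rintegral => //; first exact: integrable_norm.
  by move=> x Dx; rewrite -ler_toC; exact: le_trans (hn _) (fm _ Dx).
apply: le_trans (normC_le _) _;
  rewrite ler_toC [leRHS]mulr_natl mulr2n lerD //=.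
  by apply: aux => //; exact: norm_Re_le.
by apply: aux => //; exact: norm_Im_le.
Qed.

Lemma cintegrable_bound f (m : R -> R) : cmeasurable f ->
  mu.-integrable D (fun x => (m x)%:E) ->
  (forall x, D x -> `|f x| <= toC (m x)) -> cintegrable f.
Proof.
move=> [f1 f2] im fm.
have aux (h : C -> R) : measurable_fun D (fun x => h (f x)) ->
    (forall z, toC `|h z| <= `|z|) -> mu.-integrable D (fun x => (h (f x))%:E).
  move=> mh hn; apply: (le_integrable mD _ _ im) => //.
    exact/measurable_EFinP.
  move=> x Dx; rewrite !abse_EFin lee_fin -ler_toC.
  apply: le_trans (hn _) _; apply: le_trans (fm _ Dx) _.
  by rewrite ler_toC ler_norm.
by split; apply: aux => //; [exact: norm_Re_le|exact: norm_Im_le].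
Qed.

Lemma integrable_cst_D (M : R) : mu.-integrable D (fun=> M%:E).
Proof.
apply: continuous_compact_integrable; first exact: segment_compact.
exact/continuous_subspaceT/cst_continuous.
Qed.

Lemma cintegrable_bounded f (M : C) : cmeasurable f ->
  (forall x, D x -> `|f x| <= M) -> cintegrable f.
Proof.
move=> mf fM; apply: (@cintegrable_bound _ (fun=> Re M)) => //.
  exact: integrable_cst_D.
move=> x Dx; rewrite -toC_real; first exact: fM.
exact: le_trans (normr_ge0 _) (fM _ Dx).
Qed.

Lemma cmeasurable_cintegrable f : cintegrable f -> cmeasurable f.
Proof. by move=> [f1 f2]; split; apply/measurable_EFinP;
  [exact: (measurable_int mu f1)|exact: (measurable_int mu f2)]. Qed.

(** The norm of [Cplx R] has values in [Cplx R]; this is a real-valued majorant of it, integrable as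
    soon as the coordinates are. *)
Definition l1norm f x := `|Re (f x)| + `|Im (f x)|.

Lemma integrable_l1norm f : cintegrable f ->
  mu.-integrable D (fun x => (l1norm f x)%:E).
Proof.
move=> [f1 f2].
exact: (integrableD mD (integrable_norm f1) (integrable_norm f2)).
Qed.

Lemma norm_l1norm f x : `|f x| <= toC (l1norm f x).
Proof. exact: normC_le. Qed.

(** The bound on g is asked only where f is nonzero, so that g may be a kernel with a singularity
    outside the support of f. *)
Lemma cintegrableM f g (M : C) : cintegrable f -> cmeasurable g ->
  (forall x, D x -> f x != 0 -> `|g x| <= M) ->
  cintegrable (fun x => f x * g x).
Proof.
move=> cf mg gM.
apply: (@cintegrable_bound _ (fun x => Re `|M| * l1norm f x)).
- by apply: cmeasurableM => //; exact: cmeasurable_cintegrable.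
- exact: (integrableZl mD _ (integrable_l1norm cf)).
move=> x Dx; rewrite toCM -normC_Re normrM mulrC.
have [->|f0] := eqVneq (f x) 0; first rewrite normr0 mulr0 mulr_ge0 //.
  exact: le_trans (normr_ge0 _) (norm_l1norm f x).
apply: ler_pM => //; last exact: norm_l1norm.
have := gM _ Dx f0 => gxM; apply: le_trans gxM (real_ler_norm _).
by rewrite ger0_real //; exact: le_trans (normr_ge0 _) (gM _ Dx f0).
Qed.
End Complex_integrals.

(** * Derivation under the integral sign *)

Section Quadratic_remainder.
Context {K : numFieldType}.

(** A quadratic bound on the remainder passes through integrals, which makes this the criterion for
    differentiating them with respect to a parameter. *)
Lemma is_derive_quadratic (f : K -> K) (z d e M : K) : 0 < e ->
  (forall w, `|w - z| < e -> `|f w - f z - (w - z) * d| <= M * `|w - z| ^+ 2) ->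
  is_derive z 1 f d.
Proof.
move=> e0 fM.
(* The bound at a point other than z, here z + e / 2, forces M to be nonnegative. *)
have M0 : 0 <= M.
  have := fM (z + e / 2); rewrite [_ + _ - z]addrAC subrr add0r.
  have e2 : 0 < e / 2 by rewrite divr_gt0.
  rewrite gtr0_norm // ltr_pdivrMr // ltr_pMr // ltr1n => /(_ isT) h.
  by rewrite -(pmulr_lge0 _ (exprn_gt0 2 e2)); exact: le_trans (normr_ge0 _) h.
suff cv : h^-1 *: ((f \o shift z) (h *: (1 : K)) - f z) @[h --> 0^'] --> d.
  by apply: DeriveDef; [apply/cvg_ex; exists d|exact: cvg_lim cv].
apply/cvgrPdist_lt => eps eps0.
have eps1 : 0 < eps / (M + 1) by rewrite divr_gt0 // ltr_wpDl.
near=> h.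
have h0 : h != 0 by near: h; exact: nbhs_dnbhs_neq.
have he : `|h| < e by near: h; apply: dnbhs0_lt.
have heps : `|h| < eps / (M + 1) by near: h; apply: dnbhs0_lt.
have := fM (h + z); rewrite addrK => /(_ he) {}fM.
rewrite distrC /GRing.scale /= mulr1.
have -> : h^-1 * (f (h + z) - f z) - d = h^-1 * (f (h + z) - f z - h * d).
  by field.
rewrite normrM normfV mulrC ltr_pdivrMr ?normr_gt0 //.
apply: le_lt_trans fM _; rewrite expr2 mulrA ltr_pM2r ?normr_gt0 //.
move: heps; rewrite ltr_pdivlMr ?ltr_wpDl // mulrC; apply: le_lt_trans.
by rewrite ler_wpM2r // lerDl.
Unshelve. all: by end_near. Qed.

(** Meant for u = 1/(g - w), v = 1/(g - z) and h = w - z, where u - v = h u v is the resolvent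
    identity. It is the first order expansion of u^k at w = z, with a constant M that depends on the
    kernels only through the bound B. *)
Lemma power_remainder (k : nat) (B : K) : exists2 M : K, 0 <= M &
  forall u v h : K, `|u| <= B -> `|v| <= B -> u - v = h * u * v ->
  `|u ^+ k - v ^+ k - h * (k%:R * v ^+ k.+1)| <= M * `|h| ^+ 2.
Proof.
elim: k => [|k [M M0 IH]].
  by exists 0 => // u v h _ _ _; rewrite !expr0 subrr mul0r mulr0 subrr normr0 mul0r.
pose B1 := `|B|.
exists (B1 * M + k%:R * (B1 * B1 * B1 ^+ k.+1) + B1 ^+ k * (B1 * B1 ^+ 2)).
  by rewrite !addr_ge0 ?mulr_ge0 ?exprn_ge0 ?normr_ge0.
move=> u v h uB vB uv.
(* The product rule for u * u^k with its error terms: each of the three summands is of second order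
   in h. *)
have -> : u ^+ k.+1 - v ^+ k.+1 - h * (k.+1%:R * v ^+ k.+2) =
    u * (u ^+ k - v ^+ k - h * (k%:R * v ^+ k.+1)) +
    (u - v) * (h * (k%:R * v ^+ k.+1)) + v ^+ k * (u - v - h * v ^+ 2).
  by rewrite -(natr1 k) !exprS; ring.
have -> : u - v - h * v ^+ 2 = h ^+ 2 * (u * v ^+ 2).
  transitivity (h * v * (u - v)); last by rewrite uv; ring.
  by rewrite {1}uv; ring.
rewrite uv.
have B10 : 0 <= B1 by exact: normr_ge0.
have BB : B <= B1.
  by rewrite real_ler_norm // ger0_real //; exact: le_trans (normr_ge0 _) uB.
have uB1 : `|u| <= B1 := le_trans uB BB.
have vB1 : `|v| <= B1 := le_trans vB BB.
apply: le_trans (ler_normD _ _) _; rewrite [leRHS]mulrDl; apply: lerD.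
  apply: le_trans (ler_normD _ _) _; rewrite [leRHS]mulrDl; apply: lerD.
    rewrite normrM -mulrA; apply: ler_pM => //; exact: IH.
  have -> : h * u * v * (h * (k%:R * v ^+ k.+1)) =
    k%:R * (u * v * v ^+ k.+1) * h ^+ 2 by ring.
  rewrite !normrM !normrX normr_nat ler_wpM2r ?exprn_ge0 // ler_wpM2l //.
  by rewrite !ler_pM ?mulr_ge0 ?exprn_ge0 // lerXn2r ?nnegrE.
have -> : v ^+ k * (h ^+ 2 * (u * v ^+ 2)) =
  v ^+ k * (u * v ^+ 2) * h ^+ 2 by ring.
rewrite !normrM !normrX ler_wpM2r ?exprn_ge0 //.
by rewrite !ler_pM ?mulr_ge0 ?exprn_ge0 // lerXn2r ?nnegrE.
Qed.

End Quadratic_remainder.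

Section Derivation_under_integral.
Context {R : realType}.
Local Notation C := (Cplx R).
Local Notation Re := (@complex.Re R).
Local Notation mu := (@lebesgue_measure R).
Local Notation D := (`[0, 2 * @pi R]%classic).

Let mD : measurable (D : set (measurableTypeR R)).
Proof. exact: measurable_itv. Qed.

Lemma norm_Cintegral3_le (f g h : R -> C) (a : C) (m : R -> R) (c : C) :
  cintegrable f -> cintegrable g -> cintegrable h ->
  mu.-integrable D (fun x => (m x)%:E) -> 0 <= c ->
  (forall x, D x -> `|f x - g x - a * h x| <= toC (m x) * c) ->
  `|Cintegral D f - Cintegral D g - a * Cintegral D h| <=
  toC (2 * \int[mu]_(x in D) m x) * c.
Proof.
move=> If Ig Ih im c0 fgh.
have Ig' : cintegrable (fun x => -1 * g x) by exact: cintegrableZl.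
have Ih' : cintegrable (fun x => - a * h x) by exact: cintegrableZl.
have Ifg : cintegrable (fun x => f x + -1 * g x) by exact: cintegrableD.
have -> : Cintegral D f - Cintegral D g - a * Cintegral D h =
    Cintegral D (fun x => f x + -1 * g x + - a * h x).
  by rewrite !CintegralD // !CintegralZl // mulN1r mulNr.
rewrite (toC_real c0) -toCM -mulrA -(RintegralZr (Re c) mD im).
apply: (@norm_Cintegral_le _ _ (fun x => m x * Re c)).
  exact: cintegrableD.
  exact: (integrableZr mD (Re c) im).
by move=> x Dx; rewrite toCM -toC_real // mulN1r mulNr; exact: fgh.
Qed.

Lemma is_derive_Cintegral (F F1 : R -> C -> C) (m : R -> R) (z e : C) : 0 < e ->
  mu.-integrable D (fun x => (m x)%:E) ->
  (forall w, `|w - z| < e -> cintegrable (F^~ w)) ->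
  cintegrable (F1^~ z) ->
  (forall x w, D x -> `|w - z| < e ->
    `|F x w - F x z - (w - z) * F1 x z| <= toC (m x) * `|w - z| ^+ 2) ->
  is_derive z 1 (fun w => Cintegral D (F^~ w)) (Cintegral D (F1^~ z)).
Proof.
move=> e0 im IF IF1 Fm; pose M : C := toC (2 * \int[mu]_(x in D) m x).
apply: (is_derive_quadratic (M := M) e0) => w wz.
apply: norm_Cintegral3_le => //; first exact: IF.
  by apply: IF; rewrite subrr normr0.
by move=> x Dx; exact: Fm.
Qed.

Lemma kernel_le (a w z d : C) : 0 < d -> d <= `|a - z| -> `|w - z| < d / 2 ->
  `|(a - w)^-1| <= (d / 2)^-1.
Proof.
move=> d0 az wz; have d2 : 0 < d / 2 by rewrite divr_gt0.
have aw : d / 2 <= `|a - w|.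
  rewrite -(lerD2r `|w - z|); apply: le_trans (_ : d <= _).
    by rewrite {2}(splitr d) lerD2l ltW.
  by apply: le_trans az _; rewrite (_ : a - z =
    (a - w) + (w - z)) ?ler_normD //; ring.
by rewrite normfV lef_pV2 ?posrE // (lt_le_trans d2 aw).
Qed.

(** For k = 1 this is a Cauchy integral along the curve g, the factor dg being absorbed in phi.
    Differentiation in z raises k by one, so all powers of the kernel are treated together. *)
Definition cauchy_type (phi g : R -> C) (k : nat) (z : C) : C :=
  Cintegral D (fun x => phi x * (g x - z)^-1 ^+ k).

Section Cauchy_type.
Variables (phi g : R -> C) (z d : C).
Hypothesis phi_int : cintegrable phi.
Hypothesis g_meas : cmeasurable g.
Hypothesis d_gt0 : 0 < d.
Hypothesis dP : forall x, D x -> phi x != 0 -> d <= `|g x - z|.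

Lemma cintegrable_kernel w k : `|w - z| < d / 2 ->
  cintegrable (fun x => phi x * (g x - w)^-1 ^+ k).
Proof.
move=> wz; apply: (@cintegrableM _ _ _ ((d / 2)^-1 ^+ k)) => //.
  apply: cmeasurableX; apply: cmeasurableV; exact: cmeasurableD.
move=> x Dx px; rewrite normrX lerXn2r ?nnegrE //.
  by rewrite invr_ge0 ltW // divr_gt0.
by apply: kernel_le wz => //; exact: dP.
Qed.

(** Within d / 2 of z the kernels are bounded by (d / 2)^-1 on the support of phi, and
    [power_remainder] applies pointwise. The majorant m does not depend on w, so the bound can be
    integrated. *)
Lemma cauchy_type_remainder k : exists2 m : R -> R,
  mu.-integrable D (fun x => (m x)%:E) &
  forall x w, D x -> `|w - z| < d / 2 ->
  `|phi x * (g x - w)^-1 ^+ k - phi x * (g x - z)^-1 ^+ k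
    - (w - z) * (k%:R * (phi x * (g x - z)^-1 ^+ k.+1))|
  <= toC (m x) * `|w - z| ^+ 2.
Proof.
have [M M0 MP] := power_remainder k (d / 2)^-1.
exists (fun x => Re M * l1norm phi x).
  exact: (integrableZl mD _ (integrable_l1norm phi_int)).
move=> x w Dx wz.
have -> : phi x * (g x - w)^-1 ^+ k - phi x * (g x - z)^-1 ^+ k
    - (w - z) * (k%:R * (phi x * (g x - z)^-1 ^+ k.+1)) =
    phi x * ((g x - w)^-1 ^+ k - (g x - z)^-1 ^+ k
    - (w - z) * (k%:R * (g x - z)^-1 ^+ k.+1)) by ring.
rewrite normrM toCM -toC_real //.
rewrite [leRHS](_ : _ = toC (l1norm phi x) * (M * `|w - z| ^+ 2)); last by ring.
have [->|p0] := eqVneq (phi x) 0.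
  rewrite normr0 mul0r mulr_ge0 ?(mulr_ge0 M0) ?exprn_ge0 //.
  exact: le_trans (normr_ge0 _) (norm_l1norm phi x).
have gz := dP Dx p0.
have zz : `|z - z| < d / 2 by rewrite subrr normr0 divr_gt0.
apply: ler_pM => //; first exact: norm_l1norm.
have u := kernel_le d_gt0 gz wz; have v := kernel_le d_gt0 gz zz.
apply: MP => //.
have gz0 : g x - z != 0 by rewrite -normr_gt0 (lt_le_trans d_gt0 gz).
have gw0 : g x - w != 0.
  rewrite -normr_gt0 -(ltrD2r `|w - z|) add0r.
  apply: lt_le_trans wz _; apply: le_trans (_ : d <= _).
    by rewrite {2}(splitr d) lerDl ltW // divr_gt0.
  by apply: le_trans gz _; rewrite (_ : g x - z =
    (g x - w) + (w - z)) ?ler_normD //; ring.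
by field; rewrite gw0 gz0.
Qed.

Lemma is_derive_cauchy_type k :
  is_derive z 1 (cauchy_type phi g k) (k%:R * cauchy_type phi g k.+1 z).
Proof.
have zz : `|z - z| < d / 2 by rewrite subrr normr0 divr_gt0.
have [m im mP] := cauchy_type_remainder k.
have Ik1 := cintegrable_kernel k.+1 zz.
rewrite /cauchy_type -CintegralZl //.
apply: (is_derive_Cintegral
  (F := fun x w => phi x * (g x - w)^-1 ^+ k)
  (F1 := fun x w => k%:R * (phi x * (g x - w)^-1 ^+ k.+1)) _ im _ _ mP).
- by rewrite divr_gt0.
- by move=> w wz; exact: cintegrable_kernel.
- exact: cintegrableZl.
Qed.

End Cauchy_type.
End Derivation_under_integral.

(** * Twice complex-differentiable functions *)

Section Smooth_functions.
Context {K : numFieldType}.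
Implicit Types (f g : K -> K) (U : set K) (z : K).

(** Two complex derivatives are what the structure matrix takes: it contains the derivatives of the
    entries of Y_n and must itself be differentiable. *)
Definition smooth_at (f : K -> K) (z : K) : Prop :=
  derivable f z 1 /\ derivable (derive1 f) z 1.

Lemma cvg_derivable (f : K -> K) z : derivable f z 1 -> {for z, continuous f}.
Proof. by move=> /derivable1_diffP /differentiable_continuous. Qed.

Lemma is_derive_derive1 (f : K -> K) z : derivable f z 1 ->
  is_derive z 1 f (derive1 f z).
Proof. by move=> df; rewrite derive1E; exact: derivableP. Qed.

Lemma smooth_atP f f' U z : open U -> U z ->
  (forall w, U w -> is_derive w 1 f (f' w)) -> derivable f' z 1 ->
    smooth_at f z.
Proof.
move=> oU Uz df df'; split; first by have [] := df z Uz.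
apply: near_eq_derivable df'; near=> w; rewrite derive1E.
by have [|_ ->] := df w; first by near: w; exact: open_nbhs_nbhs.
Unshelve. all: by end_near. Qed.

Lemma smooth_cst (a : K) z : smooth_at (fun=> a) z.
Proof.
apply: (@smooth_atP _ (fun=> 0) setT) => //; exact: openT.
Qed.

Lemma smooth_id z : smooth_at (fun w => w) z.
Proof.
apply: (@smooth_atP _ (fun=> 1) setT) => //; exact: openT.
Qed.

Lemma smoothD f g U z : open U -> U z ->
  (forall w, U w -> smooth_at f w) -> (forall w, U w -> smooth_at g w) ->
  smooth_at (fun w => f w + g w) z.
Proof.
move=> oU Uz sf sg.
apply: (@smooth_atP _ (fun w => derive1 f w + derive1 g w) U) => //.
  move=> w Uw; have [df _] := sf w Uw; have [dg _] := sg w Uw.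
  exact: is_deriveD (is_derive_derive1 df) (is_derive_derive1 dg).
by have [_ df] := sf z Uz; have [_ dg] := sg z Uz; exact: derivableD.
Qed.

Lemma smoothM f g U z : open U -> U z ->
  (forall w, U w -> smooth_at f w) -> (forall w, U w -> smooth_at g w) ->
  smooth_at (fun w => f w * g w) z.
Proof.
move=> oU Uz sf sg.
apply: (@smooth_atP _ (fun w => f w * derive1 g w + g w * derive1 f w) U) => //.
  move=> w Uw; have [df _] := sf w Uw; have [dg _] := sg w Uw.
  exact: is_deriveM (is_derive_derive1 df) (is_derive_derive1 dg).
have [df df'] := sf z Uz; have [dg dg'] := sg z Uz.
by apply: derivableD; exact: derivableM.
Qed.

Lemma smoothN f U z : open U -> U z ->
  (forall w, U w -> smooth_at f w) -> smooth_at (fun w => - f w) z.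
Proof.
move=> oU Uz sf.
have -> : (fun w => - f w) = (fun w => -1 * f w) by apply/funext => w;
  rewrite mulN1r.
exact: smoothM oU Uz (fun w _ => smooth_cst (-1) w) sf.
Qed.

Lemma smoothV f U z : open U -> U z ->
  (forall w, U w -> smooth_at f w) -> (forall w, U w -> f w != 0) ->
  smooth_at (fun w => (f w)^-1) z.
Proof.
move=> oU Uz sf f0.
apply: (@smooth_atP _ (fun w => - ((f w)^-1 * (f w)^-1 * derive1 f w)) U) => //.
  move=> w Uw; have [df _] := sf w Uw.
  apply: DeriveDef; first exact: derivableV (f0 _ Uw) df.
  rewrite deriveV ?f0 // derive1E /GRing.scale /= mulNr.
  by rewrite -exprVn expr2.
have [df df'] := sf z Uz; have dV := derivableV (f0 _ Uz) df.
exact: derivableN (derivableM (derivableM dV dV) df').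
Qed.

Lemma smooth_horner (p : {poly K}) z : smooth_at (fun w => p.[w]) z.
Proof.
elim/poly_ind: p z => [|p c IHp] z.
  have -> : (fun w => (0 : {poly K}).[w]) = (fun=> 0) by apply/funext => w;
    rewrite horner0.
  exact: smooth_cst.
have -> : (fun w => (p * 'X + c%:P).[w]) = (fun w => p.[w] * w + c).
  by apply/funext => w; rewrite hornerMXaddC.
apply: (@smoothD _ _ setT) => //; [exact: openT| |by move=> w _;
  exact: smooth_cst].
by move=> w _; apply: (@smoothM _ _ setT) => // [|v _];
  [exact: openT|exact: smooth_id].
Qed.

Lemma smoothX f n U z : open U -> U z ->
  (forall w, U w -> smooth_at f w) -> smooth_at (fun w => f w ^+ n) z.
Proof.
move=> oU Uz sf; elim: n z Uz => [|n IHn] z Uz.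
  have -> : (fun w => f w ^+ 0) = (fun=> 1) by apply/funext => w; rewrite expr0.
  exact: smooth_cst.
have -> : (fun w => f w ^+ n.+1) = (fun w => f w * f w ^+ n).
  by apply/funext => w; rewrite exprS.
exact: (@smoothM _ _ U).
Qed.

Lemma is_derive_affine f (c r t d : K) : r != 0 ->
  is_derive (c + r * t) 1 f d -> is_derive t 1 (fun s => f (c + r * s)) (r * d).
Proof.
move=> r0 [df ef].
have rh : r * h @[h --> 0^'] --> 0^'.
  move=> P [e /= e0 eP]; exists (e / `|r|);
    first by rewrite /= divr_gt0 ?normr_gt0.
  move=> h /= he h0; apply: eP; last by rewrite mulf_neq0.
  move: he; rewrite /= !sub0r !normrN normrM ltr_pdivlMr ?normr_gt0 //.
  by rewrite mulrC.
have cf : h^-1 * (f (h + (c + r * t)) - f (c + r * t)) @[h --> 0^'] --> d.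
  have := df; rewrite /derivable -/('D_1 f (c + r * t)) ef.
  by under eq_fun do rewrite /GRing.scale /= mulr1.
have cv : h^-1 *: (((fun s => f (c + r * s)) \o shift t) (h *: (1 : K)) - f (c + r * t))
    @[h --> 0^'] --> r * d.
  have c1 : r * ((r * h)^-1 * (f (r * h + (c + r * t)) - f (c + r * t)))
      @[h --> 0^'] --> r * d.
    by apply: cvgM; [exact: cvg_cst|exact: (cvg_comp _ _ rh cf)].
  apply: cvg_trans c1; apply: near_eq_cvg; near=> h.
  have h0 : h != 0 by near: h; exact: nbhs_dnbhs_neq.
  rewrite /GRing.scale /= mulr1.
  have -> : c + r * (h + t) = r * h + (c + r * t) by ring.
  by field; rewrite h0.
by apply: DeriveDef; [apply/cvg_ex; exists (r * d)|exact: cvg_lim cv].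
Unshelve. all: by end_near. Qed.

Lemma smooth_affine f (c r t : K) U : r != 0 -> open U -> U t ->
  (forall s, U s -> smooth_at f (c + r * s)) -> smooth_at (fun s =>
    f (c + r * s)) t.
Proof.
move=> r0 oU Ut sf.
apply: (@smooth_atP _ (fun s => r * derive1 f (c + r * s)) U) => //.
  move=> w Uw; have [df _] := sf w Uw.
  exact: is_derive_affine (is_derive_derive1 df).
apply: derivableM; first exact: derivable_cst.
have [_ df] := sf t Ut.
by have [] := is_derive_affine r0 (is_derive_derive1 df).
Qed.

Lemma near_smooth f g U z : open U -> U z -> (forall w, U w -> f w = g w) ->
  (forall w, U w -> smooth_at f w) -> smooth_at g z.
Proof.
move=> oU Uz fg sf.
apply: (smooth_atP (f' := derive1 f) oU Uz) => [w Uw|];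
  last by have [] := sf z Uz.
have [df _] := sf w Uw.
apply: near_eq_is_derive (is_derive_derive1 df).
by apply: filterS (open_nbhs_nbhs (conj oU Uw)) => v; exact: fg.
Qed.

Lemma near_disc (P : K -> Prop) z : (\forall w \near z, P w) ->
  exists2 r : K, 0 < r & forall w, `|w - z| < r -> P w.
Proof.
move=> /nbhs_ballP[r r0 rP]; exists r => // w wz.
by apply: rP; rewrite -ball_normE /= distrC.
Qed.

Lemma open_disc (c r : K) : open [set z : K | `|z - c| < r].
Proof.
have -> : [set z : K | `|z - c| < r] = ball c r.
  by apply/seteqP; split=> z; rewrite -ball_normE /= distrC.
exact: ball_open.
Qed.

Lemma is_derive_line (a b c z : K) : is_derive z 1 (fun w => a + b * (w - c)) b.
Proof.
have -> : (fun w : K => a + b * (w - c)) = (fun w => (b * w) + (a - b * c)).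
  by apply/funext => w; ring.
apply: is_derive_eq; rewrite /GRing.scale /=; ring.
Qed.
End Smooth_functions.

(** * Cauchy's integral formula *)

Section Real_derivatives.
Context {R : realType}.
Local Notation C := (Cplx R).
Local Notation Re := (@complex.Re R).
Local Notation Im := (@complex.Im R).

(** The derivative of a complex function of a real variable, taken by coordinates so that the real
    fundamental theorem and mean value theorem apply to each. *)
Definition cderive (f : R -> C) (x : R) (v : C) : Prop :=
  is_derive x 1 (fun t => Re (f t)) (Re v) /\
  is_derive x 1 (fun t => Im (f t)) (Im v).

Lemma cderive_quotient (f : R -> C) x v : cderive f x v ->
  toC t^-1 * (f (t + x) - f x) @[t --> 0^'] --> v.
Proof.
move=> [[dRe eRe] [dIm eIm]].
have aux (h : C -> R) : derivable (fun t => h (f t)) x 1 ->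
    t^-1 * (h (f (t + x)) - h (f x)) @[t --> 0^'] --> 'D_1 (fun t => h (f t)) x.
  move=> dh; have := dh; rewrite /derivable.
  by rewrite /derive; under eq_fun do rewrite /GRing.scale /= mulr1.
apply/cvg_toC; split.
  rewrite -eRe; apply: cvg_trans (aux _ dRe); apply: near_eq_cvg; near=> t.
  by rewrite cReM cReD cReN /=; ring.
rewrite -eIm; apply: cvg_trans (aux _ dIm); apply: near_eq_cvg; near=> t.
by rewrite cImM cImD cImN /=; ring.
Unshelve. all: by end_near. Qed.

Lemma quotient_cderive (f : R -> C) x v :
  toC t^-1 * (f (t + x) - f x) @[t --> 0^'] --> v -> cderive f x v.
Proof.
move=> /cvg_toC[cRe cIm].
have aux (h : C -> R) l :
    t^-1 * (h (f (t + x)) - h (f x)) @[t --> 0^'] --> l ->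
    is_derive x 1 (fun t => h (f t)) l.
  move=> hl; have cv : t^-1 *: (((fun t =>
    h (f t)) \o shift x) (t *: (1 : R)) - h (f x)) @[t --> 0^'] --> l.
    by apply: cvg_trans hl; apply: near_eq_cvg; near=> t;
      rewrite /GRing.scale /= mulr1.
  by apply: DeriveDef; [apply/cvg_ex; exists l|exact: cvg_lim cv].
split; apply: aux.
  apply: cvg_trans cRe; apply: near_eq_cvg; near=> t.
  by rewrite cReM cReD cReN /=; ring.
apply: cvg_trans cIm; apply: near_eq_cvg; near=> t.
by rewrite cImM cImD cImN /=; ring.
Unshelve. all: by end_near. Qed.

Lemma cderive_continuous (f : R -> C) x v : cderive f x v ->
  {for x, continuous f}.
Proof.
move=> [[dRe _] [dIm _]]; apply/cvg_toC; split.
  exact: (differentiable_continuous (proj1 (derivable1_diffP _ _) dRe)).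
exact: (differentiable_continuous (proj1 (derivable1_diffP _ _) dIm)).
Qed.

Lemma cderive_comp (h : C -> C) (g : R -> C) x (d v : C) :
  is_derive (g x) 1 h d -> cderive g x v -> cderive (fun t =>
    h (g t)) x (d * v).
Proof.
move=> [dh eh] dg.
(* The slope of h at g x, continued by d, is continuous at g x. Factoring through it avoids a
   division by g (t + x) - g x, which may vanish. *)
pose eta w := if w == g x then d else (h w - h (g x)) / (w - g x).
have hE w : h w - h (g x) = (w - g x) * eta w.
  rewrite /eta; case: eqVneq => [->|wx]; first by rewrite !subrr mul0r.
  by rewrite mulrC divfK // subr_eq0.
have c_eta : eta @ g x --> d.
  have := dh; rewrite /derivable -/('D_1 h (g x)) eh.
  move=> /cvgrPdist_lt ch; apply/(@cvgrPdist_lt _ _ _ (nbhs (g x)) _) => e e0.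
  have [r /= r0 rP] := ch _ e0.
  exists r => //= w wr; rewrite /eta; case: eqVneq => [|wx].
    by rewrite subrr normr0.
  have w0 : w - g x != 0 by rewrite subr_eq0.
  have := rP (w - g x); rewrite /= sub0r normrN distrC => /(_ wr w0).
  by rewrite /GRing.scale /= mulr1 subrK mulrC.
apply: quotient_cderive; rewrite mulrC.
have -> : (fun t => toC t^-1 * (h (g (t + x)) - h (g x))) =
    (fun t => (toC t^-1 * (g (t + x) - g x)) * eta (g (t + x))).
  by apply/funext => t; rewrite hE mulrA.
apply: cvgM; first exact: cderive_quotient.
have gx : g (t + x) @[t --> 0^'] --> g x.
  have cg := cderive_continuous dg.
  have tx : t + x @[t --> (0 : R)^'] --> 0 + x.
    by apply: cvgD; [exact: nbhs_dnbhs|exact: cvg_cst].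
  by rewrite add0r in tx; exact: (cvg_comp _ _ tx cg).
exact: (cvg_comp _ _ gx c_eta).
Qed.

Lemma cderive_expi x : cderive expi x (iC * expi x).
Proof.
split; rewrite ?cReM ?cImM /= ?mul0r ?mul1r ?sub0r ?add0r ?addr0.
  exact: is_derive_cos.
exact: is_derive_sin.
Qed.

Lemma continuous_toC : continuous (@toC R).
Proof.
by move=> x; apply/cvg_toC; split; [exact: cvg_id|exact: cvg_cst].
Qed.

Lemma continuous_expi : continuous (@expi R).
Proof. by move=> x; exact: cderive_continuous (cderive_expi x). Qed.

Lemma cderive_affine (a b : C) x : cderive (fun t => a + toC t * b) x b.
Proof.
apply: quotient_cderive; apply: cvg_near_cst; near=> t.
have t0 : toC t != 0 :> C.
  by rewrite toC_eq0; near: t; exact: nbhs_dnbhs_neq.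
rewrite toCD toCV.
by field.
Unshelve. all: by end_near. Qed.
End Real_derivatives.

Section Cauchy_formula.
Context {R : realType}.
Local Notation C := (Cplx R).
Local Notation Re := (@complex.Re R).
Local Notation Im := (@complex.Im R).
Local Notation mu := (@lebesgue_measure R).
Local Notation D := (`[0, 2 * @pi R]%classic).

Let mD : measurable (D : set (measurableTypeR R)).
Proof. exact: measurable_itv. Qed.

Lemma continuous_cintegrable (f : R -> C) : continuous f -> cintegrable f.
Proof.
move=> cf; split; apply: continuous_compact_integrable.
- exact: segment_compact.
- by apply: continuous_subspaceT => x; have /cvg_toC[] := cf x.
- exact: segment_compact.
- by apply: continuous_subspaceT => x; have /cvg_toC[] := cf x.
Qed.

Lemma Cintegral_derivative_periodic (F f : R -> C) :
  (forall x, cderive F x (f x)) -> continuous f -> F 0 = F (2 * pi) ->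
  Cintegral D f = 0.
Proof.
move=> dF cf F02.
have pi0 : (0 : R) < 2 * pi by rewrite mulr_gt0 ?pi_gt0.
have aux (h : C -> R) : (forall x : R, is_derive x 1 (fun t =>
  h (F t)) (h (f x))) ->
    continuous (fun x => h (f x)) -> \int[mu]_(x in D) h (f x) = 0.
  move=> dh ch; rewrite /Rintegral.
  rewrite (continuous_FTC2 (F := fun x => h (F x)) pi0).
  - by rewrite F02 /= subrr.
  - exact: continuous_subspaceT.
  - have cF x : {for x, continuous (fun x => h (F x))}.
      apply: differentiable_continuous; apply/derivable1_diffP.
      by have [] := dh x.
    split.
    + by move=> x _; have [] := dh x.
    + exact: cvg_at_right_filter (cF 0).
    + exact: cvg_at_left_filter (cF (2 * pi)).
  - by move=> x _; rewrite derive1E; have [] := dh x.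
apply: eq_ReIm; apply: aux => x.
- by have [] := dF x.
- by have /cvg_toC[] := cf x.
- by have [] := dF x.
- by have /cvg_toC[] := cf x.
Qed.

Lemma bounded_rectangle (f : R * R -> C) (a b c d : R) :
  (forall p, (`[a, b] `*` `[c, d]) p -> {for p, continuous f}) ->
  exists M : R, forall p, (`[a, b] `*` `[c, d]) p -> `|f p| <= toC M.
Proof.
move=> cf; set K := `[a, b] `*` `[c, d].
have cK : compact K by apply: compact_setX; exact: segment_compact.
have aux (h : C -> R) : (forall p, K p -> {for p, continuous (fun p =>
  h (f p))}) ->
    exists M, forall p, K p -> `|h (f p)| <= M.
  move=> ch.
  have : bounded_set [set h (f p) | p in K].
    apply: compact_bounded; apply: continuous_compact => //.
    apply: continuous_in_subspaceT => p /[!inE]; exact: ch.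
  move=> [M [_ MP]]; exists (M + 1) => p Kp.
  by apply: (MP (M + 1)); [rewrite ltrDl|exists p].
have [p Kp|M1 M1P] := aux Re; first by have /cvg_toC[] := cf p Kp.
have [p Kp|M2 M2P] := aux Im; first by have /cvg_toC[] := cf p Kp.
exists (M1 + M2) => p Kp; apply: le_trans (normC_le _) _.
by rewrite ler_toC lerD ?M1P ?M2P.
Qed.

Section Homotopy.
Variables (h : C -> C) (rho : R) (z : C).
Hypothesis rho_gt1 : 1 < rho.
Hypothesis h_smooth : forall t, `|t| < toC rho -> smooth_at h t.
Hypothesis z_lt1 : `|z| < 1.

(** The parameter s runs over a neighbourhood [-eps, 1 + eps] of [0, 1], where |1 - s| + |s| is at
    most 1 + 2 eps, hence less than rho = 1 + 4 eps. The contracted circle [gamma s] therefore stays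
    in the disc where h is smooth. In the s-derivative [G1] of [G] the factor expi x - z of the
    chain rule cancels the denominator of [k]. *)
Let eps := (rho - 1) / 4.
Let gamma (s x : R) : C := z + toC s * (expi x - z).
Let k (x : R) : C := expi x / (expi x - z).
Let G (s x : R) : C := h (gamma s x) * k x.
Let G1 (s x : R) : C := derive1 h (gamma s x) * expi x.

Let eps_gt0 : 0 < eps. Proof. by rewrite divr_gt0 ?subr_gt0. Qed.

Let u_neq0 x : expi x - z != 0.
Proof.
apply: contraTneq z_lt1 => /eqP; rewrite subr_eq0 => /eqP <-.
by rewrite norm_expi ltxx.
Qed.

Let gamma_lt s x : - eps <= s -> s <= 1 + eps -> `|gamma s x| < toC rho.
Proof.
move=> s0 s1.
have -> : gamma s x = toC (1 - s) * z + toC s * expi x.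
  by rewrite /gamma toCB toC1; ring.
apply: le_lt_trans (ler_normD _ _) _.
rewrite !normrM !norm_toC norm_expi mulr1.
apply: (@le_lt_trans _ _ (toC (`|1 - s| + `|s|))).
  rewrite toCD lerD2r ler_piMr ?(ltW z_lt1) //.
  by rewrite (_ : 0 = toC 0) // ler_toC.
rewrite ltr_toC.
have r : rho = 1 + 4 * eps by rewrite /eps; field.
rewrite r; have e0 := eps_gt0.
by case: (ger0P s) => ?; case: (ger0P (1 - s)) => ?; lra.
Qed.

Let cderive_s s x : - eps <= s -> s <= 1 + eps -> cderive (fun s =>
  G s x) s (G1 s x).
Proof.
move=> s0 s1.
have [dh _] := h_smooth (gamma_lt x s0 s1).
have dhk : is_derive (gamma s x) 1 (fun w =>
  h w * k x) (derive1 h (gamma s x) * k x).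
  have := is_deriveM (is_derive_derive1 dh) (is_derive_cst (k x) (gamma s x) 1).
  by move=> dM; apply: is_derive_eq; rewrite /GRing.scale /=; ring.
have -> : G1 s x = derive1 h (gamma s x) * k x * (expi x - z).
  by rewrite /G1 /k -mulrA divfK.
exact: (@cderive_comp R (fun w => h w * k x) (gamma^~ x) s _ _ dhk
  (cderive_affine z (expi x - z) s)).
Qed.

Let cderive_gamma s x : cderive (gamma s) x (toC s * (iC * expi x)).
Proof.
have := is_derive_line z (toC s) z (expi x : C).
by move=> /cderive_comp /(_ (cderive_expi x)).
Qed.

Let continuous_k : continuous k.
Proof.
move=> x; apply: cvgM; first exact: continuous_expi.
apply: cvgV; first exact: u_neq0.
by apply: cvgB; [exact: continuous_expi|exact: cvg_cst].
Qed.

Let continuous_G s : - eps <= s -> s <= 1 + eps -> continuous (G s).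
Proof.
move=> s0 s1 x; apply: cvgM; last exact: continuous_k.
have [dh _] := h_smooth (gamma_lt x s0 s1).
apply: (cvg_comp (gamma s) h); last exact: cvg_derivable dh.
exact: cderive_continuous (cderive_gamma s x).
Qed.

Let continuous_G1 (p : R * R) : - eps <= p.1 -> p.1 <= 1 + eps ->
  {for p, continuous (fun p => G1 p.1 p.2)}.
Proof.
move=> p0 p1.
have ex : expi q.2 @[q --> p] --> (expi p.2 : C).
  by apply: (cvg_comp snd expi); [exact: cvg_snd|exact: continuous_expi].
apply: cvgM; last exact: ex.
have [_ dh] := h_smooth (gamma_lt p.2 p0 p1).
apply: (cvg_comp (fun q => gamma q.1 q.2) (derive1 h));
  last exact: cvg_derivable dh.
have tc : toC q.1 @[q --> p] --> (toC p.1 : C).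
  by apply: (cvg_comp fst (@toC R)); [exact: cvg_fst|exact: continuous_toC].
have eb : expi q.2 - z @[q --> p] --> expi p.2 - z by apply: (cvgB ex);
  exact: cvg_cst.
by apply: (@cvgD _ C _ _ _ (fun=> z)); [exact: cvg_cst|exact: (cvgM tc eb)].
Qed.

(** For s nonzero, [G1 s] is also an x-derivative, that of h (gamma s x) / (i s), which takes the
    same value at 0 and 2 pi. *)
Let Cintegral_G1 s : - eps <= s -> s <= 1 + eps -> s != 0 ->
  Cintegral D (G1 s) = 0.
Proof.
move=> s0 s1 sn0.
have sC : toC s * iC != 0 by rewrite mulf_neq0 ?toC_eq0 ?iC_neq0.
apply: (@Cintegral_derivative_periodic (fun x =>
  h (gamma s x) * (toC s * iC)^-1)).
- move=> x; have [dh _] := h_smooth (gamma_lt x s0 s1).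
  have dhk : is_derive (gamma s x) 1 (fun w => h w * (toC s * iC)^-1)
      (derive1 h (gamma s x) * (toC s * iC)^-1).
    have := is_deriveM (is_derive_derive1 dh) (is_derive_cst (toC s * iC)^-1 (gamma s x) 1).
    by move=> dM; apply: is_derive_eq; rewrite /GRing.scale /=; ring.
  have -> : G1 s x = derive1 h (gamma s x) * (toC s * iC)^-1 * (toC s * (iC * expi x)).
    rewrite /G1 [toC s * (iC * _)]mulrA.
    by rewrite -mulrA mulKf.
  exact: (@cderive_comp R (fun w =>
    h w * _) (gamma s) x _ _ dhk (cderive_gamma s x)).
- move=> x.
  have := @continuous_G1 (s, x) s0 s1.
  move=> cG; apply: (cvg_comp (fun y => (s, y)) (fun p => G1 p.1 p.2));
    last exact: cG.
  by apply: (@cvg_pair _ _ _ (nbhs x) (nbhs s) (nbhs x));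
    [exact: cvg_cst|exact: cvg_id].
- by rewrite /gamma expi0 expi2pi.
Qed.

(** With j the real or imaginary part, the integral of j (G s x) has zero derivative for s in ]0, 1[
    and is continuous on [0, 1], because it is differentiable on a larger interval; the mean value
    theorem concludes. *)
Let derive_part (j : C -> R) :
  (forall s x v, cderive (G^~ x) s v -> is_derive s 1 (fun t =>
    j (G t x)) (j v)) ->
  (forall s, cintegrable (G s) -> mu.-integrable D (fun x => (j (G s x))%:E)) ->
  (forall w, toC `|j w| <= `|w|) ->
  (forall s, Cintegral D (G1 s) = 0 -> \int[mu]_(x in D) j (G1 s x) = 0) ->
  \int[mu]_(x in D) j (G 1 x) = \int[mu]_(x in D) j (G 0 x).
Proof.
move=> dj ij jn j0.
pose phi s := \int[mu]_(x in D) j (G s x).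
have Iee s : `]- eps, 1 + eps[%classic s -> - eps <= s /\ s <= 1 + eps.
  by rewrite /= in_itv /= => /andP[? ?]; split; apply: ltW.
have dG s x : `]- eps, 1 + eps[%classic s -> is_derive s 1 (fun t =>
  j (G t x)) (j (G1 s x)).
  by move=> /Iee[s0 s1]; apply: dj; exact: cderive_s.
have pE s x : `]- eps, 1 + eps[%classic s -> partial1of2 (fun s x =>
  j (G s x)) s x = j (G1 s x).
  by move=> Is; rewrite /partial1of2 derive1E; have [] := dG s x Is.
(* A bound for [G1] on a compact rectangle is the constant majorant that allows differentiation
   under the integral. *)
have [p [p1 _]|M MP] := @bounded_rectangle (fun p =>
  G1 p.1 p.2) (- eps) (1 + eps) 0 (2 * pi).
  by move: p1 => /=; rewrite in_itv /= => /andP[? ?]; exact: continuous_G1.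
have iG s : `]- eps, 1 + eps[%classic s ->
  mu.-integrable D (EFin \o (fun x => j (G s x))).
  by move=> /Iee[s0 s1]; apply: ij; apply: continuous_cintegrable;
    exact: continuous_G.
have ddG s x : `]- eps, 1 + eps[%classic s -> D x -> derivable (fun t =>
  j (G t x)) s 1.
  by move=> Is _; have [] := dG s x Is.
have bG s x : `]- eps, 1 + eps[%classic s -> D x ->
    `|partial1of2 (fun s x => j (G s x)) s x| <= `|M|.
  move=> Is Dx; rewrite pE // -ler_toC; apply: le_trans (jn _) _.
  apply: le_trans (MP (s, x) _) _; last by rewrite ler_toC ler_norm.
  by split => //=; have [s0 s1] := Iee _ Is; rewrite in_itv /= s0 s1.
have iM : mu.-integrable D (EFin \o (fun=> `|M|)) by exact: integrable_cst_D.
have M0 : forall x : R, 0 <= (fun=> `|M|) x by move=> x /=.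
have dphi s : `]- eps, 1 + eps[%classic s ->
    is_derive s 1 phi (\int[mu]_(x in D) j (G1 s x)).
  move=> Is; apply: DeriveDef.
    exact: (derivable_under_integral mD Is iG ddG M0 iM bG).
  rewrite -derive1E (differentiation_under_integral mD Is iG ddG M0 iM bG).
  by apply: eq_Rintegral => x _; rewrite pE.
have e0 := eps_gt0.
have I01 c : 0 <= c -> c <= 1 -> `]- eps, 1 + eps[%classic c.
  move=> c0 c1; rewrite /= in_itv /= (lt_le_trans _ c0) ?oppr_lt0 //=.
  by rewrite (le_lt_trans c1) // ltrDl.
have d01 (c : R) : c \in `]0, 1[ -> is_derive c 1 phi 0.
  rewrite in_itv /= => /andP[c0 c1].
  have Ic : `]- eps, 1 + eps[%classic c by exact: I01 (ltW c0) (ltW c1).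
  have := dphi c Ic; rewrite j0 //.
  by have [c2 c3] := Iee _ Ic; rewrite Cintegral_G1 // gt_eqF.
have c01 : {within `[0, 1], continuous phi}.
  apply: derivable_within_continuous => c; rewrite in_itv /= => /andP[c0 c1].
  have Ic : `]- eps, 1 + eps[%classic c by exact: I01.
  by have [] := dphi c Ic.
have [c _] := @MVT _ phi (fun=> 0) 0 1 ltr01 d01 c01.
by rewrite mul0r => /eqP; rewrite subr_eq0 => /eqP.
Qed.

(* The integral of h(z + s (t - z)) / (t - z) dt does not depend on s.        *)
Lemma cauchy_homotopy :
  Cintegral D (fun x => h (expi x) * (expi x / (expi x - z))) =
  h z * Cintegral D (fun x => expi x / (expi x - z)).
Proof.
transitivity (Cintegral D (G 1)).
  by apply: eq_Cintegral => x _; rewrite /G /gamma /k toC1 mul1r [z + _]addrC subrK.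
rewrite -CintegralZl; last exact/continuous_cintegrable/continuous_k.
transitivity (Cintegral D (G 0)).
  apply: eq_ReIm; apply: derive_part.
  - by move=> s x v [].
  - by move=> s [].
  - exact: norm_Re_le.
  - by move=> s /(congr1 Re).
  - by move=> s x v [].
  - by move=> s [].
  - exact: norm_Im_le.
  - by move=> s /(congr1 Im).
by apply: eq_Cintegral => x _; rewrite /G /gamma toC0 mul0r addr0.
Qed.

End Homotopy.
End Cauchy_formula.

Section Cauchy_integral_formula.
Context {R : realType}.
Local Notation C := (Cplx R).
Local Notation D := (`[0, 2 * @pi R]%classic).

Let mD : measurable (D : set (measurableTypeR R)).
Proof. exact: measurable_itv. Qed.

Lemma Cintegral_conj (f : R -> C) : cintegrable f ->
  Cintegral D (fun x => conjC (f x)) = conjC (Cintegral D f).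
Proof.
move=> [f1 f2].
have -> : conjC (Cintegral D f) =
  (complex.Re (Cintegral D f) -i* complex.Im (Cintegral D f))%C.
  by case: (Cintegral D f).
apply: eq_ReIm => /=.
  by apply: eq_Rintegral => x _; case: (f x).
rewrite -mulN1r -(RintegralZl (-1) mD f2).
by apply: eq_Rintegral => x _; case: (f x) => a b /=; rewrite mulN1r.
Qed.

Lemma expi_neq (x : R) (z : C) : `|z| != 1 -> expi x - z != 0.
Proof. by apply: contra_neq => /eqP; rewrite subr_eq0 => /eqP <-;
  exact: norm_expi. Qed.

(** The function t / (t - z) is smooth for |t| < |z|, so its mean over the unit circle is its value
    0 at the centre. *)
Lemma winding_outside (z : C) : 1 < `|z| ->
  Cintegral D (fun x => expi x / (expi x - z)) = 0.
Proof.
move=> z1; pose rho := complex.Re `|z|.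
have zE : `|z| = toC rho := normC_Re z.
have rho1 : 1 < rho by rewrite -ltr_toC -zE.
have ct (t : C) : `|t| < `|z| -> t - z != 0.
  by apply: contraTneq => /eqP; rewrite subr_eq0 => /eqP ->; rewrite ltxx.
have oU := @open_disc C 0 `|z|.
have sh (t : C) : `|t| < toC rho -> smooth_at (fun t => t / (t - z)) t.
  rewrite -zE => tz.
  have Ut : [set w : C | `|w - 0| < `|z|] t by rewrite /= subr0.
  apply: (smoothM oU Ut) => [w _|w Uw]; first exact: smooth_id.
  apply: (smoothV oU Uw) => [v _|v]; last by rewrite /= subr0; exact: ct.
  by apply: (@smoothD _ _ _ setT) => // [|u _|u _];
    [exact: openT|exact: smooth_id|exact: smooth_cst].
have := @cauchy_homotopy R (fun t => t / (t - z)) rho 0 rho1 sh.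
rewrite normr0 mul0r mul0r => /(_ ltr01) <-.
by apply: eq_Cintegral => x _; rewrite subr0 divff ?expi_neq0 // mulr1.
Qed.

(** On the circle, t / (t - z) is the conjugate of 1 / (1 - conj z * t). The latter is smooth on a
    disc of radius larger than 1 and equals 1 at the centre, which is then its mean. *)
Lemma winding_inside (z : C) : `|z| < 1 ->
  Cintegral D (fun x => expi x / (expi x - z)) = toC (2 * pi).
Proof.
move=> z1.
have one : Cintegral D (fun x => expi x / (expi x - 0) : C) = toC (2 * pi).
  rewrite -[RHS]mulr1 -Cintegral_cst.
  by apply: eq_Cintegral => x _; rewrite subr0 divff ?expi_neq0.
pose a := complex.Re `|z|.
have zE : `|z| = toC a := normC_Re z.
have a1 : a < 1 by rewrite -ltr_toC -zE.
have a0 : 0 <= a by rewrite -ler_toC -zE toC0 normr_ge0.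
(* As a = |z| < 1, this radius satisfies both 1 < rho and a * rho < 1, so 1 - conj z * t has no zero
   for |t| < rho. *)
pose rho := 2 / (1 + a).
have rho1 : 1 < rho by rewrite /rho ltr_pdivlMr; lra.
have arho : a * rho < 1 by rewrite /rho mulrA ltr_pdivrMr; lra.
have ct (t : C) : `|t| < toC rho -> 1 - conjC z * t != 0.
  apply: contraTneq => /eqP; rewrite subr_eq0 => /eqP e.
  apply/negP => tr; have : `|conjC z * t| < 1.
    rewrite normrM normcJ zE; apply: (@le_lt_trans _ _ (toC (a * rho))).
      by rewrite toCM; apply: ler_wpM2l; [rewrite -toC0 ler_toC|exact: ltW].
    by rewrite -toC1 ltr_toC.
  by rewrite -e normr1 ltxx.
have oU := @open_disc C 0 (toC rho).
have sh (t : C) : `|t| < toC rho -> smooth_at (fun t => (1 - conjC z * t)^-1) t.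
  move=> tz.
  have Ut : [set w : C | `|w - 0| < toC rho] t by rewrite /= subr0.
  apply: (smoothV oU Ut) => [v _|v]; last by rewrite /= subr0; exact: ct.
  have -> : (fun t => 1 - conjC z * t) = (fun t =>
    (1%:P - (conjC z)%:P * 'X).[t]).
    by apply/funext => w; rewrite !hornerE.
  exact: smooth_horner.
have := @cauchy_homotopy R (fun t => (1 - conjC z * t)^-1) rho 0 rho1 sh.
rewrite normr0 mulr0 subr0 invr1 mul1r one => /(_ ltr01) e.
have kE x : expi x / (expi x - z) =
  conjC ((1 - conjC z * expi x)^-1 * (expi x / (expi x - 0))).
  have e0 := expi_neq0 x; have ez := @expi_neq x z (negbT (lt_eqF z1)).
  rewrite subr0 divff // mulr1 cconjV cconjB cconj1 cconjM cconjK conjC_expi.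
  by field; rewrite e0 ez.
transitivity (conjC (toC (2 * pi) : C)); last exact: conjc_real.
rewrite -e -Cintegral_conj; first by apply: eq_Cintegral => x _; exact: kE.
apply: continuous_cintegrable => x.
have -> : (fun x => (1 - conjC z * expi x)^-1 * (expi x / (expi x - 0))) =
    (fun x => (1 - conjC z * expi x)^-1).
  by apply/funext => y; rewrite subr0 divff ?mulr1 // expi_neq0.
have [|dh _] := sh (expi x); first by rewrite norm_expi -toC1 ltr_toC.
apply: (cvg_comp (@expi R) (fun t => (1 - conjC z * t)^-1)).
  exact: continuous_expi.
exact: cvg_derivable dh.
Qed.

(** The substitution t = c + r s carries this to the unit circle, where [cauchy_homotopy] extracts
    the value of h and [winding_inside] evaluates the remaining integral. *)
Lemma cauchy_formula (h : C -> C) (c z : C) (r rho : R) : 0 < r -> r < rho ->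
  (forall t, `|t - c| < toC rho -> smooth_at h t) -> `|z - c| < toC r ->
  Cintegral D (fun x => h (c + toC r * expi x) *
    (toC r * expi x / (c + toC r * expi x - z))) = toC (2 * pi) * h z.
Proof.
move=> r0 rrho hs zr.
have rC0 : toC r != 0 :> C by rewrite toC_eq0 gt_eqF.
have nr : `|toC r : C| = toC r by rewrite norm_toC gtr0_norm.
pose w := (z - c) / toC r.
have w1 : `|w| < 1.
  by rewrite normrM normfV nr ltr_pdivrMr ?mul1r // -toC0 ltr_toC.
have rho1 : 1 < rho / r by rewrite ltr_pdivlMr ?mul1r.
have oU := @open_disc C 0 (toC (rho / r)).
have hU (s : C) : `|s| < toC (rho / r) -> smooth_at h (c + toC r * s).
  move=> s1; apply: hs; rewrite [c + _]addrC addrK normrM nr.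
  by rewrite mulrC -ltr_pdivlMr -?toCV -?toCM // -toC0 ltr_toC.
have sh (t : C) : `|t| < toC (rho / r) -> smooth_at (fun s =>
  h (c + toC r * s)) t.
  move=> tr; apply: (smooth_affine rC0 oU) => /=; first by rewrite subr0.
  by move=> s; rewrite subr0; exact: hU.
have := cauchy_homotopy rho1 sh w1.
rewrite winding_inside // [RHS in _ = RHS ->
  _]mulrC /w [toC r * (_ / _)]mulrC divfK // [c + _]addrC subrK => <-.
apply: eq_Cintegral => x _; congr (_ * _).
have -> : c + toC r * expi x - z = toC r * (expi x - w) by rewrite /w; field.
rewrite -mulf_div divff // mul1r //.
Qed.

End Cauchy_integral_formula.

(** * The jump of a Cauchy transform across the circle *)

Section Jump.
Context {R : realType}.
Local Notation C := (Cplx R).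
Local Notation Re := (@complex.Re R).
Local Notation mu := (@lebesgue_measure R).
Local Notation D := (`[0, 2 * @pi R]%classic).

Let mD : measurable (D : set (measurableTypeR R)).
Proof. exact: measurable_itv. Qed.

Lemma smooth_cauchy_type (phi g : R -> C) (U : set C) (d : C) (k : nat) :
  cintegrable phi -> cmeasurable g -> 0 < d -> open U ->
  (forall z x, U z -> D x -> phi x != 0 -> d <= `|g x - z|) ->
  forall z, U z -> smooth_at (cauchy_type phi g k) z.
Proof.
move=> iphi mg d0 oU dP z Uz.
apply: (@smooth_atP _ _ (fun w => k%:R * cauchy_type phi g k.+1 w) U) => //.
  move=> w Uw; apply: (is_derive_cauchy_type iphi mg d0).
  by move=> x Dx; exact: dP.
apply: derivableM; first exact: derivable_cst.
have [] // : is_derive z 1 (cauchy_type phi g k.+1) (k.+1%:R * cauchy_type phi g k.+2 z).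
apply: (is_derive_cauchy_type iphi mg d0).
by move=> x Dx; exact: dP.
Qed.

(** * Divided differences as Cauchy integrals, and the decomposition of a Cauchy transform *)

Section Divided_difference.
Variables (h : C -> C) (z0 : C) (r rho : R).
Hypothesis r_gt0 : 0 < r.
Hypothesis r_lt : r < rho.
Hypothesis h_smooth : forall t, `|t - z0| < toC rho -> smooth_at h t.

Let zeta (y : R) : C := z0 + toC r * expi y.
Let psi (y : R) : C := h (zeta y) * (toC r * expi y).
Let B : C := (toC (r / 2))^-1.

(** This is 1/(2 pi i) times the contour integral of h(zeta) / ((zeta - t) (zeta - z)^k) over the
    circle |zeta - z0| = r. For k = 1 it is the divided difference of h, in a form that stays
    regular at t = z; larger k give its z-derivatives up to factors. *)
Definition divided_kernel (k : nat) (t z : C) : C :=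
  (toC (2 * pi))^-1 * cauchy_type (fun y => psi y * (zeta y - t)^-1) zeta k z.

Let norm_zeta y : `|zeta y - z0| = toC r.
Proof.
by rewrite /zeta [z0 + _]addrC addrK normrM norm_toC norm_expi mulr1 gtr0_norm.
Qed.

Let continuous_zeta : continuous zeta.
Proof.
move=> y; apply: (@cvgD _ C _ _ _ (fun=> z0)); first exact: cvg_cst.
apply: (@cvgM _ _ _ _ (fun=> toC r)); first exact: cvg_cst.
exact: continuous_expi.
Qed.

Let continuous_psi : continuous psi.
Proof.
move=> y; apply: (@cvgM _ _ _ _ (h \o zeta)).
  have [|dh _] := h_smooth (t := zeta y); first by rewrite norm_zeta ltr_toC.
  apply: (cvg_comp zeta h); first exact: continuous_zeta.
  exact: cvg_derivable dh.
apply: (@cvgM _ _ _ _ (fun=> toC r)); first exact: cvg_cst.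
exact: continuous_expi.
Qed.

Let psi_int : cintegrable psi.
Proof. exact: continuous_cintegrable continuous_psi. Qed.

Let zeta_meas : cmeasurable zeta.
Proof. exact/cmeasurable_cintegrable/continuous_cintegrable/continuous_zeta. Qed.

Let r2_gt0 : 0 < toC (r / 2) :> C.
Proof. by rewrite -toC0 ltr_toC divr_gt0. Qed.

Let zeta_far t y : `|t - z0| < toC (r / 2) -> toC (r / 2) <= `|zeta y - t|.
Proof.
move=> tz; rewrite -(lerD2r `|t - z0|); apply: le_trans (_ : toC r <= _).
  by rewrite {2}(splitr r) toCD lerD2l ltW.
rewrite -(norm_zeta y) (_ : zeta y - z0 =
  (zeta y - t) + (t - z0)) ?ler_normD //.
by ring.
Qed.

Let inv_far t y : `|t - z0| < toC (r / 2) -> `|(zeta y - t)^-1| <= B.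
Proof.
move=> tz; rewrite normfV lef_pV2 ?posrE ?zeta_far //.
exact: lt_le_trans r2_gt0 (zeta_far y tz).
Qed.

Let phi_int t : `|t - z0| < toC (r / 2) ->
  cintegrable (fun y => psi y * (zeta y - t)^-1).
Proof.
move=> tz; apply: (@cintegrableM _ _ _ B) => //.
  by apply: cmeasurableV; apply: cmeasurableD => //; exact: cmeasurable_cst.
by move=> x _ _; exact: inv_far.
Qed.

Let kernel_int k t z : `|t - z0| < toC (r / 2) -> `|z - z0| < toC (r / 2) ->
  cintegrable (fun y => psi y * (zeta y - t)^-1 * (zeta y - z)^-1 ^+ k).
Proof.
move=> tz zz; apply: (@cintegrableM _ _ _ (B ^+ k)); first exact: phi_int.
  apply: cmeasurableX; apply: cmeasurableV.
  by apply: cmeasurableD => //; exact: cmeasurable_cst.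
move=> x _ _; rewrite normrX lerXn2r ?nnegrE ?inv_far //.
by rewrite invr_ge0 ltW.
Qed.

Let pi2_neq0 : toC (2 * pi) != 0 :> C.
Proof. by rewrite toC_eq0 mulf_neq0 ?gt_eqF ?pi_gt0. Qed.

(** Cauchy's formula at t and at z, together with the partial fraction 1/(zeta - t) - 1/(zeta - z) =
    (t - z) / ((zeta - t) (zeta - z)). *)
Lemma divided_kernelE t z : `|t - z0| < toC (r / 2) ->
  `|z - z0| < toC (r / 2) ->
  t != z -> divided_kernel 1 t z = (h t - h z) / (t - z).
Proof.
move=> tz zz tNz.
have r2r : toC (r / 2) < toC r :> C
  by rewrite ltr_toC ltr_pdivrMr // ltr_pMr // ltr1n.
have zeta0 s y : `|s - z0| < toC (r / 2) -> zeta y - s != 0.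
  by move=> sz; rewrite -normr_gt0; exact: lt_le_trans r2_gt0 (zeta_far y sz).
have cf s : `|s - z0| < toC (r / 2) ->
    toC (2 * pi) * h s = Cintegral D (fun y => psi y * (zeta y - s)^-1).
  move=> sz; rewrite -(cauchy_formula r_gt0 r_lt h_smooth (lt_trans sz r2r)).
  by apply: eq_Cintegral => y _; rewrite /psi mulrA.
have tz0 : t - z != 0 by rewrite subr_eq0.
apply: (mulIf tz0); rewrite divfK // /divided_kernel.
apply: (mulfI pi2_neq0); rewrite -mulrA mulVKf // [RHS]mulrBr !cf // /cauchy_type mulrC.
rewrite -CintegralZl; last exact: kernel_int.
rewrite -mulN1r -CintegralZl; last exact: phi_int.
rewrite -CintegralD; [|exact: phi_int|by apply: cintegrableZl; exact: phi_int].
apply: eq_Cintegral => y _.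
have zt := zeta0 _ y tz; have zz' := zeta0 _ y zz.
by rewrite expr1; field; rewrite zt zz'.
Qed.

(** With the roles exchanged, the power of zeta - z joins the density, and the kernel is a
    differentiable Cauchy integral in t. *)
Lemma continuous_divided_kernel k t z :
  `|t - z0| < toC (r / 2) -> `|z - z0| < toC (r / 2) ->
  {for t, continuous (fun s => divided_kernel k s z)}.
Proof.
move=> tz zz.
have iphi : cintegrable (fun y => psi y * (zeta y - z)^-1 ^+ k).
  apply: (@cintegrableM _ _ _ (B ^+ k)) => //.
    apply: cmeasurableX; apply: cmeasurableV.
    by apply: cmeasurableD => //; exact: cmeasurable_cst.
  move=> x _ _; rewrite normrX lerXn2r ?nnegrE ?inv_far //.
  by rewrite invr_ge0 ltW.
have [|dct _] := @is_derive_cauchy_type R (fun y =>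
  psi y * (zeta y - z)^-1 ^+ k)
  zeta t (toC (r / 2)) iphi zeta_meas r2_gt0 _ 1.
  by move=> x _ _; exact: zeta_far.
have -> : (fun s => divided_kernel k s z) = (fun s => (toC (2 * pi))^-1 *
    cauchy_type (fun y => psi y * (zeta y - z)^-1 ^+ k) zeta 1 s).
  apply/funext => s; congr (_ * _); apply: eq_Cintegral => y _.
  by rewrite expr1 mulrAC.
exact: cvgM (@cvg_cst _ _ _ _ _) (cvg_derivable dct).
Qed.

Lemma divided_kernel_bounded k : exists M : C, forall t z,
  `|t - z0| < toC (r / 2) -> `|z - z0| < toC (r / 2) ->
    `|divided_kernel k t z| <= M.
Proof.
have B0 : 0 <= B by rewrite invr_ge0 ltW.
exists (`|(toC (2 * pi))^-1| * toC (2 * \int[mu]_(y in D) (l1norm psi y * Re (B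
  ^+ k.+1)))) => t z tz zz.
rewrite normrM ler_wpM2l // norm_Cintegral_le //; first exact: kernel_int.
  exact: (integrableZr mD _ (integrable_l1norm psi_int)).
move=> y _; rewrite -mulrA normrM toCM -toC_real ?exprn_ge0 //.
apply: ler_pM => //; first exact: norm_l1norm.
rewrite normrM normrX exprS; apply: ler_pM => //; first exact: inv_far.
by rewrite lerXn2r ?nnegrE ?inv_far.
Qed.

(** The constant M is uniform in t, which permits integrating the expansion over the near arc. *)
Lemma divided_kernel_remainder k z : `|z - z0| < toC (r / 4) ->
  exists M : R, forall t w, `|t - z0| < toC (r / 2) -> `|w - z| < toC (r / 4) ->
  `|divided_kernel k t w - divided_kernel k t z -
    (w - z) * (k%:R * divided_kernel k.+1 t z)| <= toC M * `|w - z| ^+ 2.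
Proof.
move=> zz.
have r4E : toC (r / 2) / 2 = toC (r / 4) :> C.
  have -> : (2 : C) = toC 2 by rewrite /toC (rmorph_nat (real_complex R)).
  by rewrite -toCV -toCM; congr toC; field.
have r42 : toC (r / 4) < toC (r / 2) :> C.
  by rewrite ltr_toC; have := r_gt0; lra.
have zz2 : `|z - z0| < toC (r / 2) := lt_trans zz r42.
have [|m im mP] := cauchy_type_remainder psi_int r2_gt0 (z := z) (g :=
  zeta) _ k.
  by move=> x _ _; exact: zeta_far.
have B0 : 0 <= B by rewrite invr_ge0 ltW.
pose M := `|(2 * pi : R)^-1| * (2 * \int[mu]_(y in D) (m y * Re B)).
exists M => t w tz wz.
have wz2 : `|w - z0| < toC (r / 2).
  have -> : w - z0 = (w - z) + (z - z0) by ring.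
  apply: le_lt_trans (ler_normD _ _) _; apply: lt_le_trans (ltrD wz zz) _.
  by rewrite -toCD ler_toC; have := r_gt0; lra.
rewrite /divided_kernel.
set c := (toC (2 * pi))^-1.
have lin (c1 a1 a2 v n a3 : C) :
  c1 * a1 - c1 * a2 - v * (n * (c1 * a3)) = c1 * (a1 - a2 - v * n * a3) by ring.
rewrite lin.
rewrite normrM /M toCM -[leRHS]mulrA -norm_toC toCV; apply: ler_wpM2l => //.
rewrite /cauchy_type; apply: norm_Cintegral3_le;
  [exact: kernel_int|exact: kernel_int|exact: kernel_int| |by rewrite exprn_ge0|].
  exact: (integrableZr mD _ im).
move=> y Dy; rewrite -r4E in wz; have := mP y w Dy wz.
rewrite toCM -toC_real // => mP'.
have lin' (c1 a0 a1 a2 v n a3 : C) : a0 * c1 * a1 - a0 * c1 * a2 - v * n * (a0 * c1 * a3) =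
  c1 * (a0 * a1 - a0 * a2 - v * (n * (a0 * a3))) by ring.
rewrite lin'.
rewrite normrM [toC (m y) * B]mulrC -[leRHS]mulrA; apply: ler_pM => //.
exact: inv_far.
Qed.

Let near_z0 (x : R) : bool := `|expi x - z0| < toC (r / 2).

Let open_near_z0 : open [set x | near_z0 x].
Proof.
have -> : [set x | near_z0 x] = expi @^-1` [set t | `|t - z0| < toC (r / 2)].
  by apply/seteqP; split=> x.
apply: open_comp; last exact: open_disc.
by move=> x _; exact: continuous_expi.
Qed.

Let near_near_z0 x : near_z0 x -> \forall y \near x, near_z0 y.
Proof. by move=> Sx; exact: (open_nbhs_nbhs (conj open_near_z0 Sx)). Qed.

Let divided_integral (k : nat) (w : C) : C := Cintegral D
  (fun x => (if near_z0 x then expi x else 0) * divided_kernel k (expi x) w).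

Let integrand_int k w : `|w - z0| < toC (r / 2) ->
  cintegrable (fun x => (if near_z0 x then expi x else 0) * divided_kernel k (expi x) w).
Proof.
move=> wz; have [M MP] := divided_kernel_bounded k.
apply: (@cintegrable_bounded _ _ `|M|).
  apply: (cmeasurable_restrict open_near_z0) => [x Sx|x /negP/negbTE ->];
    last by rewrite mul0r.
  have cK : divided_kernel k (expi y) w @[y --> x] --> divided_kernel k (expi x) w.
    apply: (cvg_comp (@expi R) (fun t => divided_kernel k t w)).
      exact: continuous_expi.
    exact: continuous_divided_kernel.
  have cv : expi y * divided_kernel k (expi y) w @[y --> x] -->
      (if near_z0 x then expi x else 0) * divided_kernel k (expi x) w.
    by rewrite Sx; exact: (cvgM (@continuous_expi R x) cK).
  apply: cvg_trans cv; apply: near_eq_cvg; near=> y.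
  have -> // : near_z0 y.
  by near: y; exact: near_near_z0.
move=> x _; case: ifPn => Sx; last by rewrite mul0r normr0.
rewrite normrM norm_expi mul1r;
  apply: le_trans (MP _ _ Sx wz) (real_ler_norm _).
by rewrite ger0_real //; exact: le_trans (normr_ge0 _) (MP _ _ Sx wz).
Unshelve. all: by end_near. Qed.

Lemma is_derive_divided_integral k z : `|z - z0| < toC (r / 4) ->
  is_derive z 1 (divided_integral k) (k%:R * divided_integral k.+1 z).
Proof.
move=> zz; have [M MP] := divided_kernel_remainder k zz.
have r42 : toC (r / 4) < toC (r / 2) :> C.
  by rewrite ltr_toC; have := r_gt0; lra.
have zz2 : `|z - z0| < toC (r / 2) := lt_trans zz r42.
rewrite /divided_integral -CintegralZl; last exact: integrand_int.
apply: (is_derive_Cintegral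
  (F := fun x w => (if near_z0 x then expi x else 0) * divided_kernel k (expi x) w)
  (F1 := fun x w => k%:R * ((if near_z0 x then expi x else 0) * divided_kernel k.+1 (expi x) w))
  (m := fun=> `|M|) (e := toC (r / 4))).
- by rewrite -toC0 ltr_toC divr_gt0.
- exact: integrable_cst_D.
- move=> w wz; apply: integrand_int.
  have -> : w - z0 = (w - z) + (z - z0) by ring.
  apply: le_lt_trans (ler_normD _ _) _; apply: lt_le_trans (ltrD wz zz) _.
  by rewrite -toCD ler_toC; have := r_gt0; lra.
- by apply: cintegrableZl; exact: integrand_int.
move=> x w _ wz.
have lin (e a1 a2 v n a3 : C) :
  e * a1 - e * a2 - v * (n * (e * a3)) = e * (a1 - a2 - v * (n * a3)) by ring.
rewrite lin normrM; case: ifPn => Sx.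
  rewrite norm_expi mul1r; apply: le_trans (MP _ _ Sx wz) _.
  by rewrite ler_wpM2r ?exprn_ge0 // ler_toC ler_norm.
by rewrite normr0 mul0r mulr_ge0 ?exprn_ge0 // -toC0 ler_toC.
Qed.

(** The part of the Cauchy transform that crosses the circle holomorphically: u - h(z) over the far
    arc, then the divided difference of h over the near arc. For |z - z0| < r / 4 the far arc keeps
    distance at least r / 4 from z. *)
Definition jump_remainder (u : R -> C) (z : C) : C :=
  (toC (2 * pi))^-1 *
  (cauchy_type (fun x => if near_z0 x then 0 else u x * expi x) expi 1 z
   + (- h z) * cauchy_type (fun x => if near_z0 x then 0 else expi x) expi 1 z
   + divided_integral 1 z).

Variable u : R -> C.
Hypothesis u_int : cintegrable u.
Hypothesis uh : forall x, D x -> `|expi x - z0| < toC rho -> u x = h (expi x).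

Let cutoff_int (f : R -> C) : cintegrable f ->
  cintegrable (fun x => if near_z0 x then 0 else f x).
Proof.
move=> fi; have -> : (fun x => if near_z0 x then 0 else f x) =
    (fun x => f x * (if near_z0 x then 0 else 1)).
  by apply/funext => x; case: ifP => _; rewrite ?mulr0 ?mulr1.
apply: (@cintegrableM _ _ _ 1) => //.
  have -> : (fun x => (if near_z0 x then 0 else 1) : C) =
      (fun x => 1 + (if near_z0 x then -1 else 0)).
    by apply/funext => x; case: ifP => _; rewrite ?subrr ?addr0.
  apply: cmeasurableD; first exact: cmeasurable_cst.
  apply: (cmeasurable_restrict open_near_z0) => [x Sx|x /negP/negbTE -> //].
  apply: cvg_near_cst; near=> y; rewrite Sx.
  by have -> // : near_z0 y; near: y; exact: near_near_z0.
by move=> x _ _; case: ifP; rewrite ?normr0 ?normr1.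
Unshelve. all: by end_near. Qed.

Let uexpi_int : cintegrable (fun x => u x * expi x).
Proof.
apply: (@cintegrableM _ _ _ 1) => //; first exact: cmeasurable_expi.
by move=> x _ _; rewrite norm_expi.
Qed.

Let expi_int : cintegrable (@expi R).
Proof. exact/continuous_cintegrable/continuous_expi. Qed.

Let r4_gt0 : 0 < toC (r / 4) :> C.
Proof. by rewrite -toC0 ltr_toC divr_gt0. Qed.

Let expi_far (f : R -> C) z x : `|z - z0| < toC (r / 4) ->
  (if near_z0 x then 0 else f x) != 0 -> toC (r / 4) <= `|expi x - z|.
Proof.
move=> zz; case: ifPn => [_|]; first by rewrite eqxx.
rewrite /near_z0 normC_Re ltr_toC -leNgt -ler_toC -normC_Re => Sx _.
rewrite -(lerD2r `|z - z0|); apply: le_trans (_ : toC (r / 2) <= _).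
  rewrite (_ : r / 2 = r / 4 + r / 4) ?toCD ?lerD2l ?ltW //; by field.
apply: le_trans Sx _.
by rewrite (_ : expi x - z0 = (expi x - z) + (z - z0)) ?ler_normD //; ring.
Qed.

Let smooth_cutoff (f : R -> C) z : cintegrable f -> `|z - z0| < toC (r / 4) ->
  smooth_at (cauchy_type (fun x => if near_z0 x then 0 else f x) expi 1) z.
Proof.
move=> fi zz.
apply: (@smooth_cauchy_type _ _ [set z | `|z - z0| < toC (r / 4)] (toC (r / 4))) => //.
- exact: cutoff_int.
- exact: cmeasurable_expi.
- exact: open_disc.
- by move=> w x wz _; exact: expi_far.
Qed.

Lemma smooth_jump_remainder z : `|z - z0| < toC (r / 4) ->
  smooth_at (jump_remainder u) z.
Proof.
move=> zz; pose U := [set z : C | `|z - z0| < toC (r / 4)].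
have oU : open U := @open_disc C z0 (toC (r / 4)).
have s1 w (Uw : U w) := smooth_cutoff uexpi_int Uw.
have s2 w (Uw : U w) := smooth_cutoff expi_int Uw.
have sh w (Uw : U w) : smooth_at h w.
  apply: h_smooth; apply: lt_trans Uw _.
  by rewrite ltr_toC; have := r_gt0; have := r_lt; lra.
have s3 w (Uw : U w) := smoothM oU Uw (fun v Uv => smoothN oU Uv sh) s2.
have s4 w (Uw : U w) : smooth_at (divided_integral 1) w.
  apply: (smooth_atP oU Uw (fun v Uv => is_derive_divided_integral 1 Uv)).
  apply: derivableM; first exact: derivable_cst.
  by have [] := is_derive_divided_integral 2 Uw.
have s5 w (Uw : U w) := smoothD oU Uw (fun v Uv => smoothD oU Uv s1 s3) s4.
exact: smoothM oU zz (fun v _ => smooth_cst _ v) s5.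
Qed.

Lemma jump_formula z : `|z - z0| < toC (r / 4) -> `|z| != 1 ->
  (toC (2 * pi))^-1 * Cintegral D (fun x => u x * (expi x / (expi x - z))) =
  jump_remainder u z +
  h z * ((toC (2 * pi))^-1 * Cintegral D (fun x => expi x / (expi x - z))).
Proof.
move=> zz z1.
have r42 : toC (r / 4) < toC (r / 2) :> C.
  by rewrite ltr_toC; have := r_gt0; lra.
have zz2 : `|z - z0| < toC (r / 2) := lt_trans zz r42.
have zzz : `|z - z| < toC (r / 4) / 2 by rewrite subrr normr0 divr_gt0.
have i1 (f : R -> C) : cintegrable f ->
    cintegrable (fun x => (if near_z0 x then 0 else f x) * (expi x - z)^-1 ^+ 1).
  move=> fi; apply: (cintegrable_kernel (z := z) (d := toC (r / 4))) => //.
  - exact: cutoff_int.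
  - exact: cmeasurable_expi.
  - by move=> x _; exact: expi_far.
have i2 := integrand_int 1 zz2.
have i3 : cintegrable (fun x => expi x / (expi x - z)).
  apply: continuous_cintegrable => x; apply: cvgM; first exact: continuous_expi.
  apply: cvgV; first exact: expi_neq.
  by apply: cvgB; [exact: continuous_expi|exact: cvg_cst].
rewrite /jump_remainder [h z * _]mulrCA -mulrDr; congr (_ * _).
have j1 := i1 _ uexpi_int.
have j2 := cintegrableZl (- h z) (i1 _ expi_int).
have j3 := cintegrableZl (h z) i3.
rewrite /cauchy_type /divided_integral.
rewrite -(CintegralZl _ (i1 _ expi_int)) -(CintegralZl _ i3) -(CintegralD j1 j2).
rewrite -(CintegralD (cintegrableD j1 j2) i2).
rewrite -(CintegralD (cintegrableD (cintegrableD j1 j2) i2) j3).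
(* The integrands agree pointwise. On the far arc the two terms with h z cancel; on the near arc u
   is h, and h z / (expi x - z) completes the divided difference. *)
apply: eq_Cintegral => x Dx; rewrite expr1.
have e0 := @expi_neq R x z z1.
case: ifPn => Sx; last by rewrite mul0r addr0; ring.
have rrho : toC (r / 2) < toC rho :> C.
  by rewrite ltr_toC; have := r_gt0; have := r_lt; lra.
have eNz : expi x != z by rewrite -subr_eq0.
rewrite (uh Dx (lt_trans Sx rrho)) (divided_kernelE Sx zz2 eNz).
have fin (a b c e : C) : e != 0 ->
    a * (b / e) = 0 * e^-1 + - c * (0 * e^-1) + b * ((a - c) / e) + c * (b / e).
  by move=> e0'; field.
exact: fin.
Qed.

End Divided_difference.

(** In [jump_formula] only the winding number of the unit circle about z, 1 inside and 0 outside,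
    distinguishes the two sides. *)
Lemma cauchy_jump (u : R -> C) (h : C -> C) (z0 : C) (rho : R) : 0 < rho ->
  cintegrable u -> (forall t, `|t - z0| < toC rho -> smooth_at h t) ->
  (forall x, D x -> `|expi x - z0| < toC rho -> u x = h (expi x)) ->
  exists2 d : R, 0 < d <= rho & exists2 E : C -> C,
    forall z, `|z - z0| < toC d -> smooth_at E z &
    forall z, `|z - z0| < toC d -> `|z| != 1 ->
      (toC (2 * pi))^-1 * Cintegral D (fun x => u x * (expi x / (expi x - z))) =
      E z + (if `|z| < 1 then h z else 0).
Proof.
move=> rho0 iu sh uh; pose r := rho / 2.
have r0 : 0 < r by rewrite divr_gt0.
have rrho : r < rho by rewrite ltr_pdivrMr // ltr_pMr // ltr1n.
exists (r / 4); first by rewrite divr_gt0 //=; lra.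
exists (jump_remainder h z0 r u);
  first exact: (smooth_jump_remainder r0 rrho sh iu).
move=> z zz z1; rewrite (jump_formula r0 rrho sh iu uh zz z1); congr (_ + _).
case: ifPn => [zin|zout].
  have pi2 : toC (2 * pi) != 0 :> C
    by rewrite toC_eq0 gt_eqF // mulr_gt0 // pi_gt0.
  by rewrite winding_inside // mulVf // mulr1.
rewrite winding_outside ?mulr0 ?mulr0 //.
have := zout; have := z1.
rewrite normC_Re -toC1 (inj_eq (@complexI R)) !ltr_toC -leNgt => ne le1.
by rewrite lt_neqAle eq_sym ne.
Qed.
End Jump.

(** * The determinant of Y *)

Section Polynomials.
Context {F : fieldType}.

(** Subtracting a multiple of [Phi n] removes the coefficient of degree n. The map s covers
    functionals that are linear as well as those that are conjugate linear. *)
Lemma monic_family_vanish (Phi : nat -> {poly F}) (L : {poly F} ->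
  F) (s : F -> F) (n : nat) :
  (forall k, Phi k \is monic) -> (forall k, size (Phi k) = k.+1) ->
  (forall p q, L (p + q) = L p + L q) -> (forall c p, L (c *: p) = s c * L p) ->
  (forall k, (k < n)%N -> L (Phi k) = 0) ->
  forall p : {poly F}, (size p <= n)%N -> L p = 0.
Proof.
move=> mPhi sPhi LD LZ; elim: n => [|n IHn] LPhi p.
  rewrite leqn0 size_poly_eq0 => /eqP ->; apply: (addrI (L 0)).
  by rewrite -LD !addr0.
move=> sp; rewrite -(subrK (p`_n *: Phi n) p) LD LZ LPhi // mulr0 addr0.
apply: IHn => [k kn|]; first by apply: LPhi; exact: ltnW.
apply/leq_sizeP => j nj; rewrite coefB coefZ.
have Pn : (Phi n)`_n = 1 by have /monicP := mPhi n; rewrite /lead_coef sPhi.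
move: nj; rewrite leq_eqVlt => /orP[/eqP <-|nj];
  first by rewrite Pn mulr1 subrr.
have -> : (Phi n)`_j = 0 by rewrite nth_default ?sPhi.
by rewrite (nth_default _ (leq_trans sp nj)) mulr0 subrr.
Qed.

(** Besides the factorization, orthogonality requires the exact size of the quotient and its leading
    coefficient. *)
Lemma horner_difference (p : {poly F}) (z : F) : exists2 w : {poly F},
  size w = (size p).-1 /\ ((1 < size p)%N -> p \is monic -> w \is monic) &
  forall t, p.[t] - p.[z] = w.[t] * (t - z).
Proof.
have rz : root (p - p.[z]%:P) z by rewrite /root !hornerE subrr.
have /factor_theorem[w wE] := rz.
exists w; last first.
  by move=> t; rewrite -[X in _ - X](hornerC _ t) -hornerN -hornerD wE !hornerE.
have [sp|sp] := leqP (size p) 1.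
  have w0 : w = 0.
    have p0 : p - p.[z]%:P = 0.
      have [c ->] : exists c, p = c%:P by exists p`_0; exact: size1_polyC.
      by rewrite hornerC subrr.
    by move: wE; rewrite p0 => /esym /eqP;
      rewrite mulf_eq0 polyXsubC_eq0 orbF => /eqP.
  by rewrite w0 size_poly0; case: (size p) sp => [|[]].
have spz : (size (- p.[z]%:P)%R < size p)%N.
  by rewrite size_polyN; apply: leq_ltn_trans (size_polyC_leq1 _) sp.
have wN0 : w != 0.
  apply: contraTneq sp => w0; move: wE; rewrite w0 mul0r => /eqP.
  by rewrite subr_eq0 => /eqP ->; rewrite -leqNgt size_polyC_leq1.
have sw : size p = (size w).+1.
  by rewrite -(size_polyDl spz) wE size_Mmonic ?monicXsubC // size_XsubC addn2.
split; first by rewrite sw.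
move=> _ mp; have : (p - p.[z]%:P) \is monic
  by rewrite monicE lead_coefDl // -monicE.
by rewrite wE monicMr // monicXsubC.
Qed.
End Polynomials.

Section Determinant.
Context {R : realType}.
Local Notation C := (Cplx R).
Local Notation D := (`[0, 2 * @pi R]%classic).

Lemma continuousCM (f g : R -> C) : continuous f -> continuous g ->
  continuous (fun x => f x * g x).
Proof. by move=> cf cg x; exact: (cvgM (cf x) (cg x)). Qed.

Lemma continuousCX (f : R -> C) n : continuous f -> continuous (fun x =>
  f x ^+ n).
Proof.
move=> cf; elim: n => [|n IHn].
  by have -> : (fun x => f x ^+ 0) = (fun=> 1); [apply/funext => x;
    rewrite expr0|exact: cst_continuous].
have -> : (fun x => f x ^+ n.+1) = (fun x => f x * f x ^+ n).
  by apply/funext => x; rewrite exprS.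
exact: continuousCM.
Qed.

Lemma continuousCV (f : R -> C) : continuous f -> (forall x, f x != 0) ->
  continuous (fun x => (f x)^-1).
Proof. by move=> cf f0 x; exact: (cvgV (f0 x) (cf x)). Qed.

Lemma continuousC_conj (f : R -> C) : continuous f -> continuous (fun x =>
  conjC (f x)).
Proof.
move=> cf x; have /cvg_toC[c1 c2] := cf x; apply/cvg_toC.
have E (z : C) : complex.Re (conjC z) =
  complex.Re z /\ complex.Im (conjC z) = - complex.Im z.
  by case: z.
split.
  by rewrite (E (f x)).1; apply: cvg_trans c1; apply: near_eq_cvg; near=> y;
    rewrite (E (f y)).1.
rewrite (E (f x)).2; apply: cvg_trans (cvgN c2); apply: near_eq_cvg; near=> y.
by rewrite (E (f y)).2.
Unshelve. all: by end_near. Qed.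

Lemma continuousC_horner (p : {poly C}) : continuous (fun x => p.[expi x]).
Proof.
move=> x; apply: (cvg_comp (@expi R) (horner p)); first exact: continuous_expi.
by have [dp _] := smooth_horner p (expi x); exact: cvg_derivable dp.
Qed.

Lemma cintegrableM_continuous (u F : R -> C) : cintegrable u -> continuous F ->
  cintegrable (fun x => F x * u x).
Proof.
move=> iu cF.
(* A degenerate rectangle bounds a function of one variable. *)
have [|M MP] := @bounded_rectangle R (fun p => F p.1) 0 (2 * pi) 0 0.
  by move=> p _; apply: (cvg_comp fst F); [exact: cvg_fst|exact: cF].
have -> : (fun x => F x * u x) = (fun x => u x * F x) by apply/funext => x;
  rewrite mulrC.
apply: (@cintegrableM _ _ _ (toC M)) => //.
  exact/cmeasurable_cintegrable/continuous_cintegrable.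
by move=> x Dx _; apply: (MP (x, 0)); split => //=; rewrite in_itv /= lexx.
Qed.

Section Orthogonal_polynomials.
Variables (nu : C -> R) (Phi : nat -> {poly C}) (kappa : nat -> R).
Hypothesis nu_weight : weight nu.
Hypothesis ortho : monic_orthogonal nu Phi kappa.

Let v (x : R) : C := toC (nu (expi x)).
(** Integration against mu: for z = expi x one has dz / (i z) = dx. *)
Let J (F : R -> C) : C := Cintegral D (fun x => F x * v x).

Lemma weight_int : cintegrable (fun x => toC (nu (expi x)) : C).
Proof.
split; first exact: nu_weight.2.
exact: (@integrable_cst_D R 0).
Qed.

Let iJ (F : R -> C) : continuous F -> cintegrable (fun x => F x * v x).
Proof. exact: cintegrableM_continuous weight_int. Qed.

Let JD (F G : R -> C) : continuous F -> continuous G -> J (fun x =>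
  F x + G x) = J F + J G.
Proof.
move=> cF cG; rewrite /J -(CintegralD (iJ cF) (iJ cG)).
by apply: eq_Cintegral => x _; rewrite mulrDl.
Qed.

Let JZ (c : C) (F : R -> C) : continuous F -> J (fun x => c * F x) = c * J F.
Proof.
move=> cF; rewrite /J -(CintegralZl c (iJ cF)).
by apply: eq_Cintegral => x _; rewrite mulrA.
Qed.

Let JE (F G : R -> C) : F =1 G -> J F = J G.
Proof. by move=> FG; apply: eq_Cintegral => x _; rewrite FG. Qed.

Let mu_integralE f : mu_integral nu f = J (fun x => f (expi x)).
Proof.
apply: eq_Cintegral => x _; rewrite /v -!mulrA; congr (_ * _).
have e0 := expi_neq0 x; have i0 := @iC_neq0 R.
by rewrite mulVf ?mulr1 // mulf_neq0.
Qed.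

Let ortho_J k j : J (fun x => (Phi k).[expi x] * conjC (Phi j).[expi x]) =
  toC (kappa k ^- 2 * (k == j)%:R).
Proof. by have [_ _ _ /(_ j)] := ortho k; rewrite mu_integralE. Qed.

Let Phi_monic k : Phi k \is monic. Proof. by have [] := ortho k. Qed.
Let Phi_size k : size (Phi k) = k.+1. Proof. by have [] := ortho k. Qed.

Let cH := continuousC_horner.
Let cHc (p : {poly C}) : continuous (fun x => conjC p.[expi x]).
Proof. by apply: continuousC_conj; exact: cH. Qed.

Let ortho_left m (p : {poly C}) : (size p <= m)%N ->
  J (fun x => p.[expi x] * conjC (Phi m).[expi x]) = 0.
Proof.
apply: (monic_family_vanish (Phi := Phi) (s := id)
  (L := fun p => J (fun x => p.[expi x] * conjC (Phi m).[expi x]))) => //.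
- move=> p1 p2; rewrite -JD; [|exact: continuousCM|exact: continuousCM].
  by apply: JE => x; rewrite hornerD mulrDl.
- move=> c p1; rewrite -JZ; last exact: continuousCM.
  by apply: JE => x; rewrite hornerZ mulrA.
- by move=> k km; rewrite ortho_J ltn_eqF // mulr0.
Qed.

Let ortho_right m (p : {poly C}) : (size p <= m)%N ->
  J (fun x => (Phi m).[expi x] * conjC p.[expi x]) = 0.
Proof.
apply: (monic_family_vanish (Phi := Phi) (s := conjC)
  (L := fun p => J (fun x => (Phi m).[expi x] * conjC p.[expi x]))) => //.
- move=> p1 p2; rewrite -JD; [|exact: continuousCM|exact: continuousCM].
  by apply: JE => x; rewrite hornerD cconjD mulrDr.
- move=> c p1; rewrite -JZ; last exact: continuousCM.
  by apply: JE => x; rewrite hornerZ cconjM mulrCA.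
- by move=> k km; rewrite ortho_J gtn_eqF // mulr0.
Qed.

(** The difference p - Phi_m has lower degree, hence is orthogonal to Phi_m. *)
Let ortho_monic m (p : {poly C}) : p \is monic -> size p = m.+1 ->
  J (fun x => p.[expi x] * conjC (Phi m).[expi x]) = toC (kappa m ^- 2).
Proof.
move=> mp sp; rewrite -[RHS]addr0 -(@ortho_left m (p - Phi m)); last first.
  apply/leq_sizeP => j; rewrite coefB leq_eqVlt => /orP[/eqP <-|mj].
    have := monicP mp; have := monicP (Phi_monic m);
      rewrite /lead_coef Phi_size sp /=.
    by move=> -> ->; rewrite subrr.
  by rewrite !nth_default ?Phi_size ?sp // subrr.
have := ortho_J m m; rewrite eqxx mulr1 => <-.
rewrite -JD; [|exact: continuousCM|exact: continuousCM].
by apply: JE => x; rewrite hornerD hornerN; ring.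
Qed.

Lemma reverse_expi m (p : {poly C}) x : (size p <= m.+1)%N ->
  (reverse m p).[expi x] = expi x ^+ m * conjC p.[expi x].
Proof. by move=> sp; rewrite reverseE ?expi_neq0 // conjC_expi invrK. Qed.

Section Fixed_degree.
Variables (m : nat) (z : C).
Hypothesis z1 : `|z| != 1.

(** The Cauchy transform of index m + 1 divides by t^(m+1); the factor t of dt = i t dx leaves the
    exponent m. *)
Let ker (p : {poly C}) x : C := p.[expi x] * (expi x)^-1 ^+ m.

Let c_inv : continuous (fun x => (expi x - z)^-1 : C).
Proof.
apply: continuousCV => [x|x]; last exact: expi_neq.
by apply: cvgB; [exact: continuous_expi|exact: cvg_cst].
Qed.

Let c_ker p : continuous (ker p).
Proof.
apply: continuousCM; first exact: cH.
apply: continuousCX.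
by apply: continuousCV; [exact: continuous_expi|move=> x; exact: expi_neq0].
Qed.

(** On the circle, u(t) t^-m is the conjugate of [reverse m u], a polynomial of degree at most m, to
    which Phi_(m+1) is orthogonal. *)
Let Phi_ker (u : {poly C}) : (size u <= m)%N -> J (fun x =>
  ker (Phi m.+1) x * u.[expi x]) = 0.
Proof.
move=> su; have sr : (size (reverse m u) <= m.+1)%N by exact: size_poly.
rewrite -(ortho_right sr); apply: JE => x.
rewrite reverse_expi ?(leq_trans su) // cconjM cconjX conjC_expi cconjK /ker.
by rewrite mulrA.
Qed.

Let reverse_ker x : ker (reverse m (Phi m)) x = conjC (Phi m).[expi x].
Proof.
rewrite /ker reverse_expi ?Phi_size // mulrAC -exprMn divff ?expi_neq0 //.
by rewrite expr1n mul1r.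
Qed.

(* s(t) - s(z) is divisible by t - z, which moves s(z) under the integral.    *)
Let horner_J (p s w : {poly C}) :
  (forall t, s.[t] - s.[z] = w.[t] * (t - z)) ->
  s.[z] * J (fun x => ker p x * (expi x - z)^-1) =
  J (fun x => ker p x * s.[expi x] * (expi x - z)^-1) - J (fun x =>
    ker p x * w.[expi x]).
Proof.
move=> wE; have cp : continuous (ker p) := @c_ker p.
have cw : continuous (fun x => ker p x * w.[expi x]) := continuousCM cp (@cH w).
have cs : continuous (fun x => ker p x * s.[expi x] * (expi x - z)^-1) :=
  continuousCM (continuousCM cp (@cH s)) c_inv.
have c1 : continuous (fun _ : R => -1 : C) by exact: cst_continuous.
rewrite -(JZ _ (continuousCM cp c_inv)) -[- J _]mulN1r -(JZ _ cw).
rewrite -(JD cs (continuousCM c1 cw)).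
apply: JE => x; have ez := expi_neq x z1.
have -> : s.[expi x] = s.[z] + w.[expi x] * (expi x - z) by rewrite -wE; ring.
have fin (a b c e : C) : e != 0 -> b * (a * e^-1) =
  a * (b + c * e) * e^-1 + -1 * (a * c).
  by move=> e0; field.
exact: fin.
Qed.

Lemma cauchy_transformE (p : {poly C}) (n : nat) : cauchy_transform nu n p z =
  (toC (2 * pi))^-1 * Cintegral D
    (fun x => (p.[expi x] * (toC (nu (expi x)) / expi x ^+ n)) * (expi x / (expi x - z))).
Proof.
rewrite /cauchy_transform /circle_integral.
have iu : cintegrable (fun x => (p.[expi x] * (toC (nu (expi x)) / expi x ^+ n)) *
    (expi x / (expi x - z))).
  have -> : (fun x => (p.[expi x] * (toC (nu (expi x)) / expi x ^+ n)) * (expi x / (expi x - z)))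
      = (fun x => (p.[expi x] * (expi x ^+ n)^-1 * (expi x / (expi x - z))) * v x).
    by apply/funext => x; rewrite /v; ring.
  have cn : continuous (fun x => (expi x ^+ n)^-1 : C) :=
    continuousCV (continuousCX (n := n) (@continuous_expi R))
      (fun x => expf_neq0 n (expi_neq0 x)).
  exact: iJ (continuousCM (continuousCM (@cH p) cn) (continuousCM (@continuous_expi R) c_inv)).
rewrite invfM -mulrA; congr (_ * _).
rewrite (_ : Cintegral _ _ = iC * Cintegral D (fun x => (p.[expi x] *
  (toC (nu (expi x)) / expi x ^+ n)) * (expi x / (expi x - z)))).
  by rewrite mulKf // iC_neq0.
by rewrite -(CintegralZl iC iu); apply: eq_Cintegral => x _; ring.
Qed.

Let cauchy_transform_ker p : cauchy_transform nu m.+1 p z =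
  (toC (2 * pi))^-1 * J (fun x => ker p x * (expi x - z)^-1).
Proof.
rewrite cauchy_transformE; congr (_ * _); apply: eq_Cintegral => x _.
have e0 := expi_neq0 x; have ez := expi_neq x z1.
rewrite /ker /v exprS exprVn.
have em0 : expi x ^+ m != 0 by rewrite expf_neq0.
by field; rewrite e0 ez em0.
Qed.

(** By [horner_J] the polynomial values at z move under the integrals. The terms that keep the
    kernel 1/(t - z) are the same for both products and cancel. Of the two others, one pairs
    Phi_(m+1) with degree less than m and vanishes; the other pairs a monic polynomial of degree m
    with Phi_m and gives kappa_m^-2, which b_m / (2 pi) normalizes to 1. *)
Lemma det_Y : (Phi m.+1).[z] * (- toC (b_coef kappa m) *
    cauchy_transform nu m.+1 (reverse m (Phi m)) z) -
  cauchy_transform nu m.+1 (Phi m.+1) z *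
    (- toC (b_coef kappa m) * (reverse m (Phi m)).[z]) = 1.
Proof.
set Q := reverse m (Phi m); set P := Phi m.+1.
have [w [sw mw] wE] := horner_difference P z.
have [w' [sw' _] wE'] := horner_difference Q z.
have eP := horner_J Q wE; have eQ := horner_J P wE'.
have J1 : J (fun x => ker Q x * w.[expi x]) = toC (kappa m ^- 2).
  rewrite -(@ortho_monic m w); last 2 first.
  - by apply: mw; [rewrite Phi_size|exact: Phi_monic].
  - by rewrite sw Phi_size.
  by apply: JE => x; rewrite reverse_ker mulrC.
have J2 : J (fun x => ker P x * w'.[expi x]) = 0.
  apply: Phi_ker; rewrite sw'.
  by have := size_poly m.+1 (fun k => conjC (Phi m)`_(m - k)); case: (size _).
have J3 : J (fun x => ker Q x * P.[expi x] * (expi x - z)^-1) =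
    J (fun x => ker P x * Q.[expi x] * (expi x - z)^-1).
  by apply: JE => x; rewrite /ker; ring.
rewrite !cauchy_transform_ker.
have pi0 : toC (2 * pi) != 0 :> C
  by rewrite toC_eq0 gt_eqF // mulr_gt0 // pi_gt0.
have k0 : kappa m != 0 by have [_ _ /gt_eqF ->] := ortho m.
transitivity ((toC (2 * pi))^-1 * toC (b_coef kappa m) *
  (Q.[z] * J (fun x => ker P x * (expi x - z)^-1) -
   P.[z] * J (fun x => ker Q x * (expi x - z)^-1))); first by ring.
rewrite eP eQ J1 J2 J3 /b_coef.
rewrite (_ : _ - 0 - _ = toC (kappa m ^- 2)); last by ring.
by rewrite (toCM (2 * pi)) mulKf // -toCM divff ?expf_neq0 ?toC1.
Qed.

End Fixed_degree.
End Orthogonal_polynomials.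
End Determinant.

(** * The structure matrix *)

Section Matrices.
Context {R : realType}.
Local Notation C := (Cplx R).

Lemma mx2_inj (a b c d a' b' c' d' : C) :
  a = a' -> b = b' -> c = c' -> d = d' -> mx2 a b c d = mx2 a' b' c' d'.
Proof. by move=> -> -> -> ->. Qed.

Lemma matrix_mx2 (M : 'M[C]_2) : M = mx2 (M 0 0) (M 0 1) (M 1 0) (M 1 1).
Proof.
apply/matrixP => i j; rewrite mxE.
by case: i => [[|[|i]] hi] //; case: j => [[|[|j]] hj] //=; congr (M _ _);
  apply: val_inj.
Qed.

Lemma mulmx_mx2 (a b c d a' b' c' d' : C) :
  mx2 a b c d *m mx2 a' b' c' d' =
  mx2 (a * a' + b * c') (a * b' + b * d') (c * a' + d * c') (c * b' + d * d').
Proof.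
rewrite [LHS]matrix_mx2; apply: mx2_inj;
  by rewrite !mxE !big_ord_recl big_ord0 addr0 !mxE.
Qed.

Lemma addmx_mx2 (a b c d a' b' c' d' : C) :
  mx2 a b c d + mx2 a' b' c' d' = mx2 (a + a') (b + b') (c + c') (d + d').
Proof. by rewrite [LHS]matrix_mx2; apply: mx2_inj; rewrite !mxE. Qed.

Lemma scalemx_mx2 (k a b c d : C) :
  k *: mx2 a b c d = mx2 (k * a) (k * b) (k * c) (k * d).
Proof. by rewrite [LHS]matrix_mx2; apply: mx2_inj; rewrite !mxE. Qed.

Lemma invmx_mx2 (a b c d : C) : a * d - b * c = 1 ->
  invmx (mx2 a b c d) = mx2 d (- b) (- c) a.
Proof.
move=> det1.
have M1 : mx2 a b c d *m mx2 d (- b) (- c) a = 1%:M.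
  rewrite mulmx_mx2 [RHS]matrix_mx2; apply: mx2_inj; rewrite !mxE /=.
  - by rewrite mulrN.
  - by rewrite mulrN mulrC addNr.
  - by rewrite mulrN mulrC subrr.
  - by rewrite -det1; ring.
have [uM _] := mulmx1_unit M1.
by rewrite -[LHS]mulmx1 -M1 mulmxA mulVmx // mul1mx.
Qed.

(* Y' Y^-1 + delta Y diag(1, -1) Y^-1 for Y = [[a, b], [c, e]], det Y = 1.    *)
Definition log_derivative_mx (a b c e delta : C -> C) (z : C) : 'M[C]_2 :=
  mx2 (derive1 a z * e z - derive1 b z * c z + delta z * (a z * e z + b z * c z))
      (derive1 b z * a z - derive1 a z * b z - 2 * (delta z * (a z * b z)))
      (derive1 c z * e z - derive1 e z * c z + 2 * (delta z * (c z * e z)))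
      (derive1 e z * a z - derive1 c z * b z - delta z * (b z * c z + a z * e z)).

Lemma derivable_log_derivative_mx (a b c e delta : C -> C) (z : C) :
  smooth_at a z -> smooth_at b z -> smooth_at c z -> smooth_at e z ->
  derivable delta z 1 ->
  forall i j, derivable (fun w => log_derivative_mx a b c e delta w i j) z 1.
Proof.
move=> [a0 a1] [b0 b1] [c0 c1] [e0 e1] d0 i j.
have c2 : derivable (fun=> 2 : C) z 1 by exact: derivable_cst.
have ae := derivableM a0 e0; have bc := derivableM b0 c0.
rewrite /log_derivative_mx /mx2.
have -> : (fun w => log_derivative_mx a b c e delta w i j) = (fun w =>
    if i == 0 then
      if j == 0 then
        derive1 a w * e w - derive1 b w * c w + delta w * (a w * e w + b w * c w)
      else derive1 b w * a w - derive1 a w * b w - 2 * (delta w * (a w * b w))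
    else
      if j == 0 then
        derive1 c w * e w - derive1 e w * c w + 2 * (delta w * (c w * e w))
      else derive1 e w * a w - derive1 c w * b w - delta w * (b w * c w + a w * e w)).
  by apply/funext => w; rewrite mxE.
case: (i == 0); case: (j == 0).
- exact: derivableD (derivableB (derivableM a1 e0) (derivableM b1 c0))
    (derivableM d0 (derivableD ae bc)).
- exact: derivableB (derivableB (derivableM b1 a0) (derivableM a1 b0))
    (derivableM c2 (derivableM d0 (derivableM a0 b0))).
- exact: derivableD (derivableB (derivableM c1 e0) (derivableM e1 c0))
    (derivableM c2 (derivableM d0 (derivableM c0 e0))).
- exact: derivableB (derivableB (derivableM e1 a0) (derivableM c1 b0))
    (derivableM d0 (derivableD bc ae)).
Qed.

(* Y is multiplied on the right by [[1, omega], [0, 1]].                      *)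
Lemma log_derivative_mx_jump (a b b' c e e' delta omega : C -> C) (z : C) :
  derivable a z 1 -> derivable c z 1 -> derivable b z 1 -> derivable e z 1 ->
  is_derive z 1 omega (2 * delta z * omega z) ->
  (\forall w \near z, b' w = b w + a w * omega w) ->
  (\forall w \near z, e' w = e w + c w * omega w) ->
  log_derivative_mx a b' c e' delta z = log_derivative_mx a b c e delta z.
Proof.
move=> da dc db de dw bE eE.
have aux (f g g' : C -> C) : derivable f z 1 -> derivable g z 1 ->
    (\forall w \near z, g' w = g w + f w * omega w) ->
    derive1 g' z = derive1 g z + (f z * (2 * delta z * omega z) + omega z * derive1 f z).
  move=> df dg gE; rewrite derive1E (near_eq_derive _ gE).
  have := is_deriveD (is_derive_derive1 dg) (is_deriveM (is_derive_derive1 df) dw).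
  by case.
rewrite /log_derivative_mx (aux _ _ _ da db bE) (aux _ _ _ dc de eE).
rewrite (nbhs_singleton bE) (nbhs_singleton eE).
move: (a z) (b z) (c z) (e z) (delta z) (omega z) (derive1 a z) (derive1 b z)
  (derive1 c z) (derive1 e z) => a0 b0 c0 e0 d w a1 b1 c1 e1.
by apply: mx2_inj; ring.
Qed.

End Matrices.

(** * Limits through the complement of the circle *)

Section Extension.
Context {R : realType}.
Local Notation C := (Cplx R).

Definition off_circle : set C := [set w | `|w| != 1].

(** The circle has empty interior: a point on it is moved radially outward by the factor 1 + eps /
    2. Hence limits through [off_circle] are unique. *)
Lemma off_circle_proper (z : C) : ProperFilter (within off_circle (nbhs z)).
Proof.
apply: within_nbhs_proper => B; rewrite -nbhs_ballE => -[eps /= eps0 epsB].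
have [z1|z1] := eqVneq `|z| 1; last by exists z; split=> //; exact/epsB/ballxx.
have e2 : 0 < eps / 2 by rewrite divr_gt0.
exists (z * (1 + eps / 2)); split.
  rewrite /off_circle /= normrM z1 mul1r ger0_norm ?addr_ge0 ?(ltW e2) //.
  by rewrite -subr_eq0 [1 + _]addrC addrK gt_eqF.
apply: epsB; rewrite -ball_normE /= (_ : z - _ = - (z * (eps / 2)));
  last by ring.
by rewrite normrN normrM z1 mul1r gtr0_norm // ltr_pdivrMr // ltr_pMr // ltr1n.
Qed.

(** Identifies the limit of F with every local continuous extension, so local extensions need not be
    compared with each other. *)
Lemma extension_off_circle (F : C -> C) (z g_r : C) (g : C -> C) : 0 < g_r ->
  (forall w, `|w - z| < g_r -> derivable g w 1) ->
  (forall w, `|w - z| < g_r -> `|w| != 1 -> F w = g w) ->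
  forall w, `|w - z| < g_r -> lim (F v @[v --> within off_circle (nbhs w)]) =
    g w.
Proof.
move=> r0 dg Fg w wz.
have pf := off_circle_proper w.
apply: cvg_lim; first exact: norm_hausdorff.
have cg : g v @[v --> within off_circle (nbhs w)] --> g w.
  exact: cvg_trans (cvg_app g (cvg_within off_circle)) (cvg_derivable (dg w wz)).
apply: cvg_trans cg; apply: near_eq_cvg.
have near_w : \forall v \near w, `|v - z| < g_r.
  exact: (open_nbhs_nbhs (conj (@open_disc C z g_r) wz)).
by apply: filterS near_w => v vz v1; rewrite Fg.
Qed.
End Extension.

Section Structure_matrix.
Context {R : realType}.
Local Notation C := (Cplx R).
Local Notation D := (`[0, 2 * @pi R]%classic).
Variables (nu : C -> R) (Phi : nat -> {poly C}) (kappa : nat -> R).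
Variables (A : {poly C}) (q : C -> C) (m : nat).
Hypothesis nu_weight : weight nu.
Hypothesis ortho : monic_orthogonal nu Phi kappa.
Hypothesis semiclassical : generalized_semiclassical nu A q.

(** The index is n = m + 1: [a], [G P], [c], [e] are the entries of Y_n, row by row, and [delta] is
    the scalar of C_n' C_n^-1. *)
Let P := Phi m.+1.
Let Q := reverse m (Phi m).
Let beta : C := - toC (b_coef kappa m).
Let G (p : {poly C}) (z : C) : C := cauchy_transform nu m.+1 p z.
Let a (z : C) : C := P.[z].
Let c (z : C) : C := beta * Q.[z].
Let e (z : C) : C := beta * G Q z.
Let delta (z : C) : C := - (m.+1%:R / (2 * z)) + q z / (2 * z * A.[z]).
Let density (p : {poly C}) (x : R) : C :=
  p.[expi x] * (toC (nu (expi x)) / expi x ^+ m.+1).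

Let smooth_a z : smooth_at a z. Proof. exact: smooth_horner. Qed.

Let smooth_scale (k : C) (f : C -> C) (U : set C) z : open U -> U z ->
  (forall w, U w -> smooth_at f w) -> smooth_at (fun w => k * f w) z.
Proof. by move=> oU Uz sf; exact: smoothM oU Uz (fun w _ =>
  smooth_cst k w) sf. Qed.

Let smooth_c z : smooth_at c z.
Proof. by apply: (smooth_scale beta (U := setT) openT) => // w _;
  exact: smooth_horner. Qed.

Lemma structure_mx_log_derivative z : `|z| != 1 ->
  structure_mx nu Phi kappa A q m.+1 z = log_derivative_mx a (G P) c e delta z.
Proof.
move=> z1; rewrite /structure_mx /dlogC_mx.
have YE w : Y_mx nu Phi kappa m.+1 w = mx2 (a w) (G P w) (c w) (e w) by [].
have -> : mx_derive (Y_mx nu Phi kappa m.+1) z =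
    mx2 (derive1 a z) (derive1 (G P) z) (derive1 c z) (derive1 e z).
  have EY i j f : (forall w, Y_mx nu Phi kappa m.+1 w i j = f w) ->
      mx_derive (Y_mx nu Phi kappa m.+1) z i j = derive1 f z.
    by move=> /funext Ef; rewrite mxE Ef.
  rewrite [LHS]matrix_mx2; apply: mx2_inj; apply: EY => w; by rewrite mxE.
rewrite YE invmx_mx2; last exact: det_Y.
rewrite -/(delta z) scalemx_mx2 !mulmx_mx2 addmx_mx2 /log_derivative_mx.
move: (a z) (G P z) (c z) (e z) (delta z) (derive1 a z) (derive1 (G P) z)
  (derive1 c z) (derive1 e z) => a0 b0 c0 e0 d a1 b1 c1 e1.
by apply: mx2_inj; ring.
Qed.

Let density_int p : cintegrable (density p).
Proof.
have cn : continuous (fun x => (expi x ^+ m.+1)^-1 : C) :=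
  continuousCV (continuousCX (n := m.+1) (@continuous_expi R))
    (fun x => expf_neq0 m.+1 (expi_neq0 x)).
have -> : density p = (fun x => (p.[expi x] * (expi x ^+ m.+1)^-1) * toC (nu (expi x))).
  by apply/funext => x; rewrite /density mulrA mulrAC.
exact: cintegrableM_continuous (weight_int nu_weight)
  (continuousCM (@continuousC_horner R p) cn).
Qed.

Let near_off_circle (z : C) : `|z| != 1 -> exists2 d : C, 0 < d &
  forall w, `|w - z| < d -> `|w| != 1 /\ forall x, d <= `|expi x - w|.
Proof.
(* Half the distance from z to the circle: it is both the radius of the disc and the distance this
   disc keeps from the circle. *)
move=> z1; pose d : C := `| `|z| - 1| / 2.
have d0 : 0 < d by rewrite divr_gt0 // normr_gt0 subr_eq0.
have d2 : d + d = `| `|z| - 1| by rewrite -splitr.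
exists d => // w wz; split.
  apply: contraTneq wz => w1; apply/negP => wz.
  have : `| `|z| - `|w| | <= `|z - w| := ler_dist_dist _ _.
  rewrite w1 -d2 distrC => /le_lt_trans /(_ wz).
  by rewrite gtrDl (lt_gtF d0).
move=> x; rewrite -(lerD2r `|w - z|); apply: le_trans (_ : d + d <= _).
  by rewrite lerD2l ltW.
rewrite d2; apply: le_trans (_ : `|z - expi x| <= _).
  by rewrite -(norm_expi x); exact: ler_dist_dist.
by rewrite distrC (_ : expi x - z = (expi x - w) + (w - z)) ?ler_normD //; ring.
Qed.

Lemma smooth_cauchy_transform p z : `|z| != 1 -> smooth_at (G p) z.
Proof.
move=> z1; have [d d0 dP] := near_off_circle z1.
have oU := @open_disc C z d.
have Uz : [set w : C | `|w - z| < d] z by rewrite /= subrr normr0.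
pose phi x := density p x * expi x.
have iphi : cintegrable phi.
  apply: (@cintegrableM _ _ _ 1) => //; first exact: cmeasurable_expi.
  by move=> x _ _; rewrite norm_expi.
apply: (near_smooth (f := fun w =>
  (toC (2 * pi))^-1 * cauchy_type phi expi 1 w) oU Uz).
  move=> w /dP[w1 _]; rewrite /G cauchy_transformE //; congr (_ * _).
  by apply: eq_Cintegral => x _; rewrite /phi expr1 mulrA.
move=> w Uw; apply: (smooth_scale _ oU Uw) => v Uv.
apply: (smooth_cauchy_type (d := d) 1 iphi (@cmeasurable_expi R) d0 oU _ Uv).
by move=> v' x /dP[_ ] + _ _; exact.
Qed.

Let smooth_e z : `|z| != 1 -> smooth_at e z.
Proof.
move=> z1; have [d d0 dP] := near_off_circle z1.
have oU := @open_disc C z d.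
have Uz : [set w : C | `|w - z| < d] z by rewrite /= subrr normr0.
by apply: (smooth_scale _ oU Uz) => w /dP[w1 _]; exact: smooth_cauchy_transform.
Qed.

Let derivable_zA z : derivable (fun w : C => w * A.[w]) z 1.
Proof.
have -> : (fun w : C => w * A.[w]) = (fun w => ('X * A).[w]).
  by apply/funext => w; rewrite hornerM hornerX.
by have [] := smooth_horner ('X * A) z.
Qed.

Let near_zA (z : C) : z * A.[z] != 0 -> \forall w \near z, w * A.[w] != 0.
Proof. by move=> zA; have := cvg_derivable (@derivable_zA z); move/cvgr_neq0;
  apply. Qed.

Let derivable_delta (z : C) : z * A.[z] != 0 -> derivable delta z 1.
Proof.
move=> zA; have [_ qe _] := semiclassical.
have z0 : z != 0 by move: zA; rewrite mulf_eq0 negb_or => /andP[].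
have k (x : C) : derivable (fun=> x) z 1 by exact: derivable_cst.
have did : derivable (fun w : C => w) z 1 by have [] := smooth_id z.
have -> : delta = (fun w => - (m.+1%:R / 2 * w^-1) + q w * (2^-1 * (w * A.[w])^-1)).
  by apply/funext => w; rewrite /delta !invfM; ring.
have dzA := @derivable_zA z.
have d1 := derivableN (derivableM (k (m.+1%:R / 2)) (derivableV z0 did)).
have d2 := derivableM (qe z I) (derivableM (k 2^-1) (derivableV (f :=
  fun w : C => w * A.[w]) zA dzA)).
exact: derivableD d1 d2.
Qed.

(** Agreement with [structure_mx] is asked only off the circle, where M_n is defined. *)
Definition local_extension (z : C) : Prop :=
  exists2 r : C, 0 < r & exists g : C -> 'M[C]_2, forall w, `|w - z| < r ->
    (forall i j, derivable (fun v => g v i j) w 1) /\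
    (`|w| != 1 -> structure_mx nu Phi kappa A q m.+1 w = g w).

Lemma local_extension_off_circle z : `|z| != 1 -> z * A.[z] != 0 ->
  local_extension z.
Proof.
move=> z1 zA; have [d d0 dP] := near_off_circle z1.
have [r r0 rP] := near_disc (near_zA zA).
(* The order of [Cplx R] is partial, but positive elements are real and hence comparable; s is the
   smaller one. *)
have [s [s0 sd sr]] : exists s : C, [/\ 0 < s, s <= d & s <= r].
  have dR := gtr0_real d0; have rR := gtr0_real r0.
  case: (real_leP dR rR) => [dr|/ltW rd]; first by exists d.
  by exists r.
exists s => //; exists (log_derivative_mx a (G P) c e delta) => w wz.
have [w1 _] := dP w (lt_le_trans wz sd).
have wA := rP w (lt_le_trans wz sr).
split; last by move=> _; exact: structure_mx_log_derivative.
apply: derivable_log_derivative_mx.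
- exact: smooth_a.
- exact: smooth_cauchy_transform.
- exact: smooth_c.
- exact: smooth_e.
- exact: derivable_delta.
Qed.

Section On_circle.
Variables (U : set C) (f : C -> C) (z0 : C) (rho : R).
Hypothesis rho_gt0 : 0 < rho.
Hypothesis UP : forall z, `|z - z0| < toC rho -> U z.
Hypothesis f_hol : holomorphic_on U f.
Hypothesis f_nu : forall z, U z -> unit_circle z -> f z = toC (nu z).
Hypothesis f_eq : forall z, U z -> z * A.[z] * derive1 f z = q z * f z.
Hypothesis zAP : forall z, `|z - z0| < toC rho -> z * A.[z] != 0.

(** The analytic germ of nu / t^n, the off-diagonal entry of the jump of Y_n. *)
Let omega (z : C) : C := f z * (z ^+ m.+1)^-1.

Let oV : open [set z : C | `|z - z0| < toC rho].
Proof. exact: open_disc. Qed.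

Let z_neq0 z : `|z - z0| < toC rho -> z != 0.
Proof. by move=> /zAP; rewrite mulf_eq0 negb_or => /andP[]. Qed.

Let derive_f z : `|z - z0| < toC rho ->
  is_derive z 1 f (q z * f z / (z * A.[z])).
Proof.
move=> Vz; have zA := zAP Vz.
have -> : q z * f z / (z * A.[z]) = derive1 f z.
  by rewrite -(f_eq (UP Vz)) mulrC mulKf.
exact: is_derive_derive1 (f_hol (UP Vz)).
Qed.

(** The second derivative comes from the differential equation: f' = q f / (z A) is again
    differentiable. *)
Let smooth_f z : `|z - z0| < toC rho -> smooth_at f z.
Proof.
move=> Vz; have [_ qe _] := semiclassical.
apply: (smooth_atP oV Vz) => [w Vw|]; first exact: derive_f.
exact: derivableM (derivableM (qe z I) (f_hol (UP Vz)))
  (derivableV (f := fun w : C => w * A.[w]) (zAP Vz) (@derivable_zA z)).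
Qed.

Let smooth_omega z : `|z - z0| < toC rho -> smooth_at omega z.
Proof.
move=> Vz; apply: (smoothM oV Vz smooth_f) => w Vw.
apply: (smoothV oV Vw) => [v Vv|v Vv]; last by rewrite expf_neq0 ?z_neq0.
exact: smoothX oV Vv (fun u _ => smooth_id u).
Qed.

(** The logarithmic derivative of f / z^n is q / (z A) - n / z = 2 delta. This is where the
    semiclassical equation makes the jump disappear. *)
Let derive_omega z : `|z - z0| < toC rho ->
  is_derive z 1 omega (2 * delta z * omega z).
Proof.
move=> Vz; have z0' := z_neq0 Vz.
have A0 : A.[z] != 0 by have := zAP Vz; rewrite mulf_eq0 negb_or => /andP[].
have df : dlog f z (q z / (z * A.[z])) by rewrite /dlog mulrAC; exact: derive_f.
have did : dlog (fun w : C => w) z z^-1.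
  by rewrite /dlog mulVf //; exact: is_derive_id.
have zn0 : z ^+ m.+1 != 0 by rewrite expf_neq0.
have := dlogM df (@dlogV _ (fun w => w ^+ m.+1) z _ zn0 (dlogX m.+1 did)).
rewrite /dlog /omega (_ : q z / (z * A.[z]) + - (m.+1%:R * z^-1) =
  2 * delta z) //.
by rewrite /delta !invfM mulrDr; field; rewrite z0' A0.
Qed.

(** The extension is [log_derivative_mx] with both Cauchy transforms replaced by their continuations
    [EP] and [EQ]. Near a point w off the circle the true second column differs from the continued
    one by [om] times the first, and [om], being omega or 0, satisfies the equation required by
    [log_derivative_mx_jump]. *)
Lemma local_extension_circle : local_extension z0.
Proof.
have sh (p : {poly C}) z : `|z - z0| < toC rho -> smooth_at (fun z =>
  p.[z] * omega z) z.
  by move=> Vz; exact: smoothM oV Vz (fun w _ =>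
    smooth_horner p w) smooth_omega.
have uh (p : {poly C}) x : D x -> `|expi x - z0| < toC rho -> density p x =
  p.[expi x] * omega (expi x).
  move=> _ Vx; rewrite /density /omega f_nu //; first exact: UP.
  exact: norm_expi.
have [d1 /andP[d10 d1r] [EP sEP jP]] :=
  cauchy_jump rho_gt0 (@density_int P) (@sh P) (@uh P).
have [d2 /andP[d20 d2r] [EQ sEQ jQ]] :=
  cauchy_jump rho_gt0 (@density_int Q) (@sh Q) (@uh Q).
pose d := Num.min d1 d2.
have d0 : 0 < d by rewrite lt_min d10 d20.
have dd1 z : `|z - z0| < toC d -> `|z - z0| < toC d1.
  by move=> /lt_le_trans; apply; rewrite ler_toC ge_min lexx.
have dd2 z : `|z - z0| < toC d -> `|z - z0| < toC d2.
  by move=> /lt_le_trans; apply; rewrite ler_toC ge_min lexx orbT.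
have ddr z : `|z - z0| < toC d -> `|z - z0| < toC rho.
  by move=> /dd1 /lt_le_trans; apply; rewrite ler_toC.
have oW := @open_disc C z0 (toC d).
have sEQ' z : `|z - z0| < toC d2 -> smooth_at (fun w => beta * EQ w) z.
  by move=> Vz; exact: smooth_scale (@open_disc C z0 (toC d2)) Vz sEQ.
exists (toC d); first by rewrite -toC0 ltr_toC.
exists (log_derivative_mx a EP c (fun w => beta * EQ w) delta) => w wz; split.
  apply: derivable_log_derivative_mx.
  - exact: smooth_a.
  - exact: sEP (dd1 _ wz).
  - exact: smooth_c.
  - exact: sEQ' (dd2 _ wz).
  - exact: derivable_delta (zAP (ddr _ wz)).
move=> w1; rewrite structure_mx_log_derivative //.
have [s s0 sP] := near_off_circle w1.
(* The side of the circle is locally constant off it, so the same branch of the jump holds in a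
   whole neighbourhood of w, as derivatives require. *)
have inE : \forall v \near w, (`|v| < 1) = (`|w| < 1).
  have [win|wout] := boolP (`|w| < 1).
    have w01 : [set z : C | `|z - 0| < 1] w by rewrite /= subr0.
    apply: filterS (open_nbhs_nbhs (conj (@open_disc C 0 1) w01)) => v /=.
    by rewrite subr0 => ->.
  have w_ge1 : 1 <= `|w| by rewrite real_leNgt ?normr_real ?real1.
  have w01 : [set z : C | `|z - w| < `|w| - 1] w.
    by rewrite /= subrr normr0 subr_gt0 lt_neqAle eq_sym w1.
  apply: filterS (open_nbhs_nbhs (conj (@open_disc C w (`|w| - 1)) w01)) =>
    v /= vw.
  apply/negbTE; rewrite -real_leNgt ?normr_real ?real1 //.
  rewrite -(lerD2r `|v - w|); apply: le_trans (_ : `|w| <= _).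
    by rewrite -lerBrDl ltW.
  by rewrite -[X in `|X| <= _](subrK v) addrC distrC ler_normD.
pose om v : C := if `|w| < 1 then omega v else 0.
have jE (p : {poly C}) (E : C -> C) : (forall z, `|z - z0| < toC d ->
  `|z| != 1 ->
    (toC (2 * pi))^-1 * Cintegral D (fun x =>
      density p x * (expi x / (expi x - z))) =
    E z + (if `|z| < 1 then p.[z] * omega z else 0)) ->
    \forall v \near w, G p v = E v + p.[v] * om v.
  move=> jp; have Ws := open_nbhs_nbhs (conj oW wz).
  have ww : [set z : C | `|z - w| < s] w by rewrite /= subrr normr0.
  have Wo := open_nbhs_nbhs (conj (@open_disc C w s) ww).
  apply: filterS3 Ws Wo inE => v vz vw ve; have [v1 _] := sP v vw.
  rewrite /G cauchy_transformE // jp // /om ve.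
  by case: (`|w| < 1) => //; rewrite mulr0.
have gP := jE P EP (fun z Wz => jP z (dd1 z Wz)).
have gQ := jE Q EQ (fun z Wz => jQ z (dd2 z Wz)).
have [sE1 _] := sEP w (dd1 w wz).
have [sE2 _] := sEQ' w (dd2 w wz).
have [da _] := smooth_a w; have [dc _] := smooth_c w.
apply: (log_derivative_mx_jump da dc sE1 sE2 _ gP (omega := om)).
  rewrite /om; case: (`|w| < 1); first exact: derive_omega (ddr w wz).
  by rewrite mulr0; exact: is_derive_cst.
by apply: filterS gQ => v gv; rewrite /e gv /c; ring.
Qed.
End On_circle.

Lemma local_extension_exists z : z * A.[z] != 0 -> local_extension z.
Proof.
move=> zA; have [z1|] := eqVneq `|z| 1;
  last by move/local_extension_off_circle; apply.
have [_ _ /(_ z z1)[|U [f [[oU Uz] f_hol f_nu f_eq]]]] := semiclassical;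
  first exact/eqP.
have nU : \forall w \near z, U w /\ w * A.[w] != 0.
  by apply: filterI; [exact: (open_nbhs_nbhs (conj oU Uz))|exact: near_zA].
have [r r0 rP] := near_disc nU.
have rE := toC_real (ltW r0).
rewrite rE in r0 rP.
have rho0 : 0 < complex.Re r by rewrite -ltr_toC toC0.
apply: (local_extension_circle rho0 _ f_hol f_nu f_eq) => w /rP[] //.
Qed.
End Structure_matrix.

Theorem proposition3p3 (R : realType) (nu : Cplx R -> R)
    (Phi : nat -> {poly Cplx R}) (kappa : nat -> R)
    (A : {poly Cplx R}) (q : Cplx R -> Cplx R) :
  weight nu ->
  monic_orthogonal nu Phi kappa ->
  generalized_semiclassical nu A q ->
  forall n : nat, (0 < n)%N ->
  exists M : Cplx R -> 'M[Cplx R]_2,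
    mx_holomorphic_on (~` zeros_zA A) M /\
    forall z, ~ unit_circle z -> ~ zeros_zA A z ->
      M z = structure_mx nu Phi kappa A q n z.
Proof.
move=> nu_weight ortho semiclassical [//|m] _.
(* A single formula for all z, so that the local extensions glue without any choice. *)
pose M (z : Cplx R) : 'M[Cplx R]_2 := \matrix_(i < 2, j < 2)
  (lim (structure_mx nu Phi kappa A q m.+1 v i j @[v --> within (@off_circle R)
    (nbhs z)]) : Cplx R).
have ext z : ~ zeros_zA A z -> local_extension nu Phi kappa A q m z.
  by move=> /eqP; exact: local_extension_exists.
have ME z : ~ zeros_zA A z -> exists2 r : Cplx R, 0 < r & exists g : Cplx R -> 'M[Cplx R]_2,
    forall w, `|w - z| < r -> [/\ M w = g w,
      forall i j, derivable (fun v => g v i j) w 1 &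
      `|w| != 1 -> structure_mx nu Phi kappa A q m.+1 w = g w].
  move=> /ext[r r0 [g gP]]; exists r => //; exists g => w wz.
  have [dg gE] := gP w wz; split=> //; apply/matrixP => i j; rewrite mxE.
  apply: (extension_off_circle (F := fun v =>
    structure_mx nu Phi kappa A q m.+1 v i j)
    (g := fun v => g v i j) r0 _ _ wz) => v /gP[dgv gEv]; first exact: dgv.
  by move=> /gEv ->.
exists M; split=> [i j z /ME[r r0 [g gP]]|z /eqP z1 /ME[r r0 [g gP]]].
  have zz : [set w : Cplx R | `|w - z| < r] z by rewrite /= subrr normr0.
  have [_ dg _] := gP z zz.
  apply: near_eq_derivable (dg i j).
  apply: filterS (open_nbhs_nbhs (conj (@open_disc (Cplx R) z r) zz)) =>
    w /gP[-> _ _] //.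
have [|-> _ ->] := gP z; by rewrite ?subrr ?normr0.
Qed.
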